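(* (i) Let $E$ be a Banach space with the approximation property. Then $\mathcal{K}(E)$ is topologically left Noetherian if and only if the dual space $E'$ is separable. (ii) Let $E$ be a Banach space such that $E'$ has the bounded approximation property. Then $\mathcal{K}(E)$ is topologically right Noetherian if and only if $E$ is separable.
   Context: $\mathcal{K}(E)$ is the Banach algebra of compact operators on $E$, with composition as product and the operator norm; $E'$ is the Banach dual of $E$. A Banach space $E$ has the approximation property if for every compact $K\subset E$ and every $\varepsilon>0$ there is a bounded finite-rank operator $T$ on $E$ with $\|Tx-x\|<\varepsilon$ for all $x\in K$; it has the bounded approximation property if there is a constant $C>0$ such that $T$ can always be chosen with $\|T\|\le C$. For a Banach algebra $A$, $A^\sharp$ denotes its (conditional) unitisation: $A^\sharp=A$ if $A$ is unital, and $A^\sharp$ is $A$ with an identity adjoined otherwise. $A$ is topologically left Noetherian if every closed left ideal $I$ of $A$ is topologically finitely-generated, i.e. there exist $n\in\mathbb{N}$ and $x_1,\ldots,x_n\in I$ with $I=\overline{A^\sharp x_1+\cdots+A^\sharp x_n}$ (norm closure). $A$ is topologically right Noetherian if every closed right ideal $I$ of $A$ is of the form $\overline{x_1A^\sharp+\cdots+x_nA^\sharp}$ for some $n\in\mathbb{N}$ and $x_1,\ldots,x_n\in I$. *)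

(* Defs.v *)
From HB Require Import structures.
From mathcomp Require Import all_boot all_order all_algebra.
From mathcomp Require Import all_classical all_reals all_analysis.
From mathcomp Require Import finmap complex.

Set Implicit Arguments.
Unset Strict Implicit.
Unset Printing Implicit Defensive.

Import Order.TTheory GRing.Theory Num.Theory.
Import numFieldNormedType.Exports.

Local Open Scope classical_set_scope.
Local Open Scope ring_scope.

(* Banach spaces are real or complex: [scalarFieldType] covers both cases, up to
   the choice of a model [R] of the real numbers. In the complex case norms,
   and bounds such as [0 < e], live in [R[i]], where [0 < e] forces [e] to be
   real. *)
Definition real_or_complex (K : numFieldType) : Prop :=
  exists R : realType,
    K = (R : numFieldType) \/ K = (R[i] : numFieldType).

HB.mixin Record NumField_isScalarField K & Num.NumField K := {
  scalar_field_subproof : real_or_complex (Num.NumField.clone K _)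
}.

#[short(type="scalarFieldType")]
HB.structure Definition ScalarField :=
  {K of Num.NumField K & NumField_isScalarField K}.

Lemma scalarFieldP (K : scalarFieldType) : real_or_complex K.
Proof. exact: (@scalar_field_subproof K). Qed.

Definition real_scalars (R : realType) : scalarFieldType :=
  HB.pack (Num.NumField.sort R) (NumField_isScalarField.Build R
    (ex_intro _ R (or_introl erefl))).

Definition complex_scalars (R : realType) : scalarFieldType :=
  HB.pack (Num.NumField.sort R[i]) (NumField_isScalarField.Build R[i]
    (ex_intro _ R (or_intror erefl))).

Lemma scalar_has_supremum (K : numFieldType) (A : set K) (M : K) :
  real_or_complex K -> A !=set0 -> (forall a, A a -> 0 <= a) -> ubound A M ->
  supremums A !=set0.
Proof.
case=> R; case=> KE; subst K.
  move=> A0 _ AM; have hA : has_sup A by split=> //; exists M.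
  exists (sup A : R); split; first exact: (sup_upper_bound hA).
  by move=> y yA; apply: (ge_sup A0).
move=> A0 Age0 AM; have real z : A z -> z = (complex.Re z)%:C%C.
  by move=> /Age0 /ger0_real /RRe_real.
pose B : set R := [set r | A (r%:C)%C].
have B0 : B !=set0 by case: A0 => z Az; exists (complex.Re z); rewrite /B/= -real.
have ubB (y : R[i]) : ubound A y -> ubound B (complex.Re y).
  by move=> yA r /yA; rewrite lecE => /andP[].
have hB : has_sup B by split=> //; exists (complex.Re M); apply: ubB.
exists ((sup B)%:C%C : R[i]); split.
  move=> z Az; rewrite (real _ Az) lecR; apply: (sup_upper_bound hB).
  by rewrite /B/= -real.
move=> y yA; have yE : y = ((complex.Re y)%:C)%C.
  have [z Az] := A0; have /RRe_real -> // : y \is Num.real.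
  by apply: ger0_real; apply: (le_trans (Age0 _ Az)); apply: yA.
by rewrite yE lecR; apply: (ge_sup B0); apply: ubB.
Qed.

Section BoundedOperators.
Context {K : numFieldType} (E F : normedModType K).

Definition bounded_operator (f : E -> F) : Prop :=
  linear f /\ exists M : K, forall x, `|f x| <= M * `|x|.

Definition bounded_operatorb : {pred E -> F} :=
  fun f => `[< bounded_operator f >].

Record bounded_op := Bop { bop_fun :> E -> F; _ : bounded_operatorb bop_fun }.

HB.instance Definition _ := [isSub for bop_fun].
HB.instance Definition _ := [Choice of bounded_op by <:].

Lemma bopP (f : bounded_op) : bounded_operator f.
Proof. by case: f => f /= /asboolP. Qed.

HB.instance Definition _ (f : bounded_op) :=
  GRing.isLinear.Build K E F *:%R f (bopP f).1.

Fact bounded_operator_submod : submod_closed bounded_operatorb.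
Proof.
split=> [|a f g]; rewrite !unfold_in !asboolE.
  have E0 x : (0 : E -> F) x = 0 by [].
  split=> [k x y|]; first by rewrite !E0 scaler0 addr0.
  by exists 0 => x; rewrite E0 mul0r normr0.
move=> [lf [M fM]] [lg [N gN]]; split.
  move=> k x y; rewrite !fctE lf lg !scalerDr !addrA; congr (_ + _).
  by rewrite !scalerA mulrC -!addrA; congr (_ + _); rewrite addrC.
exists (`|a| * M + N) => x; rewrite !fctE mulrDl.
apply: (le_trans (ler_normD _ _)); apply: lerD => //.
by rewrite normrZ -mulrA ler_wpM2l.
Qed.

HB.instance Definition _ :=
  GRing.isSubmodClosed.Build K (E -> F) bounded_operatorb
    bounded_operator_submod.
HB.instance Definition _ :=
  [SubChoice_isSubLmodule of bounded_op by <:].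

End BoundedOperators.

Section OperatorNorm.
Context {K : scalarFieldType}.
Variables (E F : normedModType K).
Implicit Types f g : bounded_op E F.

(* [supremum] is taken in the partial order of [K]; it is a genuine least upper
   bound by [scalar_has_supremum]. *)
Definition opnorm f : K :=
  supremum 0 [set `|f x| | x in [set x : E | `|x| <= 1]].

Let ball_image f := [set `|f x| | x in [set x : E | `|x| <= 1]].

Let ball_image_bound f (M : K) : (forall x, `|f x| <= M * `|x|) -> 0 <= M ->
  ubound (ball_image f) M.
Proof.
move=> fM M0 _ [x /= x1 <-]; apply: (le_trans (fM x)).
by rewrite -[leRHS]mulr1 ler_wpM2l.
Qed.

Let ball_image_neq0 f : ball_image f !=set0.
Proof. by exists `|f 0|; exists 0 => //=; rewrite normr0 ler01. Qed.

Lemma bop_bound f : exists2 M : K, 0 <= M & forall x, `|f x| <= M * `|x|.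
Proof.
have [_ [M fM]] := bopP f; exists `|M| => // x.
have [->|x0] := eqVneq x 0; first by rewrite linear0 !normr0 mulr0.
have xgt0 : 0 < `|x| by rewrite normr_gt0.
apply: (le_trans (fM x)); apply: ler_wpM2r => //; apply: real_ler_norm.
apply: ger0_real; rewrite -(pmulr_lge0 _ xgt0).
exact: le_trans (fM x).
Qed.

Let opnormP f : supremums (ball_image f) (opnorm f).
Proof.
rewrite /opnorm /supremum ifF; last first.
  apply/negbTE/set0P; exact (ball_image_neq0 f).
have [M M0 fM] := bop_bound f.
have /cid[s sP] : supremums (ball_image f) !=set0.
  apply: (scalar_has_supremum (scalarFieldP K) (ball_image_neq0 f)).
  - by move=> _ [x _ <-].
  - exact: ball_image_bound fM M0.
by case: xgetP => // /(_ s).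
Qed.

Lemma opnorm_ge0 f : 0 <= opnorm f.
Proof.
have [+ _] := opnormP f; move/(_ `|f 0|); rewrite linear0 normr0; apply.
by exists 0 => /=; rewrite ?normr0 ?ler01// linear0 normr0.
Qed.

Lemma le_opnorm f x : `|f x| <= opnorm f * `|x|.
Proof.
have [->|x0] := eqVneq x 0; first by rewrite linear0 !normr0 mulr0.
have xgt0 : 0 < `|x| by rewrite normr_gt0.
rewrite -ler_pdivrMr//; have [+ _] := opnormP f; apply.
exists (`|x|^-1 *: x) => /=.
  by rewrite normrZ ger0_norm ?invr_ge0// mulVf ?gt_eqF.
by rewrite linearZ/= normrZ ger0_norm ?invr_ge0// mulrC.
Qed.

Lemma opnorm_le f (M : K) :
  0 <= M -> (forall x, `|f x| <= M * `|x|) -> opnorm f <= M.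
Proof.
by move=> M0 fM; have [_] := opnormP f; apply; apply: ball_image_bound.
Qed.

Lemma bopDE f g x : (f + g) x = f x + g x. Proof. by []. Qed.
Lemma bopBE f g x : (f - g) x = f x - g x. Proof. by []. Qed.
Lemma bopZE (a : K) f x : (a *: f) x = a *: f x. Proof. by []. Qed.
Lemma bop0E x : (0 : bounded_op E F) x = 0. Proof. by []. Qed.

Lemma bop_linearD f x y : f (x + y) = f x + f y.
Proof. exact: linearD. Qed.
Lemma bop_linearZ f (a : K) x : f (a *: x) = a *: f x.
Proof. exact: linearZ. Qed.

Fact opnormD f g : opnorm (f + g) <= opnorm f + opnorm g.
Proof.
apply: opnorm_le => [|x]; first by rewrite addr_ge0// opnorm_ge0.
rewrite bopDE mulrDl; apply: (le_trans (ler_normD _ _)).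
by apply: lerD; apply: le_opnorm.
Qed.

Let opnormZ_le (a : K) f : opnorm (a *: f) <= `|a| * opnorm f.
Proof.
apply: opnorm_le => [|x]; first by rewrite mulr_ge0// opnorm_ge0.
by rewrite bopZE normrZ -mulrA ler_wpM2l// le_opnorm.
Qed.

Fact opnormZ (a : K) f : opnorm (a *: f) = `|a| * opnorm f.
Proof.
apply/le_anti; rewrite opnormZ_le/=.
have [->|a0] := eqVneq a 0; first by rewrite normr0 mul0r opnorm_ge0.
rewrite -ler_pdivlMl ?normr_gt0// -normfV.
by rewrite -[in leLHS](scalerK a0 f) opnormZ_le.
Qed.

Fact opnorm_eq0 f : opnorm f = 0 -> f = 0.
Proof.
move=> f0; apply/val_inj/funext => x; apply/eqP; rewrite -normr_le0.
by have := le_opnorm f x; rewrite f0 mul0r.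
Qed.

HB.instance Definition _ :=
  Lmodule_isNormed.Build K (bounded_op E F) opnormD opnormZ opnorm_eq0.

Lemma bop_normE f : `|f| = opnorm f. Proof. by []. Qed.

Lemma bop_continuous f : continuous f.
Proof.
apply: bounded_linear_continuous; apply/linear_boundedP.
near=> r => x; apply: (le_trans (le_opnorm f x)); apply: ler_wpM2r => //.
near: r; apply: nbhs_pinfty_ge; exact/ger0_real/opnorm_ge0.
Unshelve. all: by end_near. Qed.

End OperatorNorm.


Section OperatorComplete.
Context {K : scalarFieldType}.

Lemma norm_sub_limit_le (V : normedModType K) T (G : set_system T)
    (GG : ProperFilter G) (u : T -> V) (l c : V) (M : K) :
  u @ G --> l -> (\forall t \near G, `|c - u t| <= M) -> `|c - l| <= M.
Proof.
move=> ul cM; apply/ler_addgt0Pr => e e0.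
near G => t; rewrite -(subrKA (u t)); apply: (le_trans (ler_normD _ _)).
apply: lerD; first by near: t.
rewrite distrC; apply/ltW; near: t; move/cvgrPdist_lt: ul; exact.
Unshelve. all: by end_near. Qed.

Variables (E : normedModType K) (F : completeNormedModType K).

Lemma bop_complete (G : set_system (bounded_op E F)) :
  ProperFilter G -> cauchy G -> cvg G.
Proof.
move=> GG /cauchy_ballP cG.
have near2 (e : K) : 0 < e -> \forall f \near G & g \near G, `|f - g| < e.
  move=> e0; have := cG _ e0; apply: filterS => -[f g] /=.
  by rewrite -ball_normE.
have gex : forall x : E, exists l : F, (fun f : bounded_op E F => f x) @ G --> l.
  move=> x; suff c : cauchy ((fun f : bounded_op E F => f x) @ G) by exists (lim ((fun f : bounded_op E F => f x) @ G)); exact: cauchy_cvg.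
  apply/cauchy_ballP => e e0; rewrite near_map2.
  have x1 : 0 < 1 + `|x| by rewrite ltr_pwDl.
  have := near2 _ (divr_gt0 e0 x1); apply: filterS => -[f h] /= fh.
  rewrite -ball_normE /= -bopBE; apply: (le_lt_trans (le_opnorm _ _)).
  apply: (@le_lt_trans _ _ (`|f - h| * (1 + `|x|))).
    by rewrite ler_wpM2l ?opnorm_ge0// lerDr.
  by rewrite -ltr_pdivlMr.
have [g gP] := boolp.choice gex.
have gdist (e : K) f : 0 <= e -> (\forall h \near G, `|f - h| <= e) ->
    forall x, `|f x - g x| <= e * `|x|.
  move=> e0 fh x; refine (@norm_sub_limit_le F _ G GG (fun f : bounded_op E F => f x) (g x) (f x) _ (gP x) _).
  apply: filterS fh => h fh; rewrite -bopBE.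
  by apply: (le_trans (le_opnorm _ _)); rewrite ler_wpM2r.
have glin : linear g.
  move=> a x y; apply: (norm_cvg_unique (gP _)).
  have -> : (fun f : bounded_op E F => f (a *: x + y)) = (fun f => a *: f x + f y).
    by apply/funext => f; exact: linearP.
  by apply: cvgD; [apply: cvgZr|]; exact: gP.
have gbop : bounded_operator g.
  split=> //; near G => f0; exists (1 + `|f0|) => x.
  rewrite mulrDl -[g x](subrK (f0 x)); apply: (le_trans (ler_normD _ _)).
  rewrite lerD ?le_opnorm// distrC; apply: gdist => //.
  apply: filterS; [move=> h; exact: ltW|].
  near: f0; exact: nearP_dep (near2 _ ltr01).
apply/cvg_ex; exists (Bop (asboolT gbop)); apply/cvgrPdist_le => e e0.
near=> f; apply: opnorm_le => [|x]; first exact: ltW.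
rewrite bopBE distrC; apply: gdist; first exact: ltW.
apply: filterS; [move=> h; exact: ltW|].
near: f; exact: nearP_dep (near2 _ e0).
Unshelve. all: by end_near. Qed.

HB.instance Definition _ := Uniform_isComplete.Build (bounded_op E F) bop_complete.

End OperatorComplete.

(* not necessarily unital, unlike the rings of the library *)
HB.mixin Record CompleteNormedModule_isBanachAlgebra (K : numFieldType) A
    & CompleteNormedModule K A := {
  bmul : A -> A -> A;
  bmulA : forall x y z, bmul x (bmul y z) = bmul (bmul x y) z;
  bmulDl : forall x y z, bmul (x + y) z = bmul x z + bmul y z;
  bmulDr : forall x y z, bmul x (y + z) = bmul x y + bmul x z;
  bmulZl : forall (a : K) x y, bmul (a *: x) y = a *: bmul x y;
  bmulZr : forall (a : K) x y, bmul x (a *: y) = a *: bmul x y;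
  bmul_norm : forall x y, `|bmul x y| <= `|x| * `|y|
}.

#[short(type="banachAlgType")]
HB.structure Definition BanachAlgebra (K : numFieldType) :=
  {A of CompleteNormedModule K A & CompleteNormedModule_isBanachAlgebra K A}.

Section CompactOperators.
Context {K : scalarFieldType} (E : completeNormedModType K).
Implicit Types f g : bounded_op E E.

Definition compact_operator f : Prop :=
  precompact (f @` [set x : E | `|x| <= 1]).

Definition compact_operatorb : {pred bounded_op E E} :=
  fun f => `[< compact_operator f >].

Record compact_op := CompactOp {
  compact_op_val :> bounded_op E E; _ : compact_operatorb compact_op_val }.

HB.instance Definition _ := [isSub for compact_op_val].
HB.instance Definition _ := [Choice of compact_op by <:].

Lemma compact_opP (f : compact_op) : compact_operator f.
Proof. by case: f => f /= /asboolP. Qed.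

Let compactW (A B : set E) : A `<=` B -> compact B -> precompact A.
Proof.
move=> AB cB; apply: (precompact_subset AB).
exact: compact_precompact (@norm_hausdorff _ _) cB.
Qed.

Fact compact_operator_submod : submod_closed compact_operatorb.
Proof.
split=> [|a f g]; rewrite !unfold_in !asboolE.
  apply: (compactW _ (@compact_set1 _ (0 : E))).
  by move=> _ [x _ <-]; rewrite bop0E.
rewrite /compact_operator !precompactE => cf cg; rewrite -precompactE.
pose h (p : E * E) : E := a *: p.1 + p.2.
apply: (@compactW _ (h @` (closure (f @` [set x | `|x| <= 1]) `*`
                         closure (g @` [set x | `|x| <= 1])))).
  move=> _ [x x1 <-]; exists (f x, g x) => //=.
  by split; apply: subset_closure; exists x.
apply: continuous_compact; last exact: compact_setX.
apply: continuous_subspaceT => p; rewrite /h.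
apply: cvgD; last exact: cvg_snd.
by apply: cvgZr; exact: cvg_fst.
Qed.

HB.instance Definition _ :=
  GRing.isSubmodClosed.Build K (bounded_op E E) compact_operatorb
    compact_operator_submod.
HB.instance Definition _ := [SubChoice_isSubLmodule of compact_op by <:].

Let knorm (f : compact_op) : K := `|val f|.
Let knormD (f g : compact_op) : knorm (f + g) <= knorm f + knorm g.
Proof. exact: ler_normD. Qed.
Let knormZ (a : K) (f : compact_op) : knorm (a *: f) = `|a| * knorm f.
Proof. exact: normrZ. Qed.
Let knorm_eq0 (f : compact_op) : knorm f = 0 -> f = 0.
Proof. by move=> /normr0_eq0 f0; apply: val_inj. Qed.

HB.instance Definition _ :=
  Lmodule_isNormed.Build K compact_op knormD knormZ knorm_eq0.

Lemma compact_op_normE (f : compact_op) : `|f| = `|f : bounded_op E E|.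
Proof. by []. Qed.

Lemma compact_operator_limit (l : bounded_op E E) :
  (forall e : K, 0 < e -> exists2 f, compact_operator f & `|l - f| < e) ->
  compact_operator l.
Proof.
move=> lf; rewrite /compact_operator precompactE compact_ultra => U UU UA.
set A := closure _ in UA *.
have cU : cauchy U.
  apply/cauchyP => e e0; apply: contrapT => /forallNP nball.
  have e4 : 0 < e / 4 by rewrite divr_gt0.
  have [f + lfe] := lf _ e4.
  rewrite /compact_operator precompactE compact_cover.
  move=> /(_ E setT (fun y => ball y (e / 4))) [|y _|D _ Dcov].
  - by move=> y _; exact: ball_open.
  - by exists y => //; exact: ballxx.
  have UD : U (\bigcap_(y in [set` D]) ~` ball y e).
    apply: filter_bigI => y _.
    by have [|//] := in_ultra_setVsetC (ball y e) UU; move/nball.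
  have [y [Ay yD]] := filter_ex (filterI UA UD).
  have [_ [[x x1 <-]]] := Ay _ (nbhsx_ballx y _ e4).
  have [z /= Dz] := Dcov (f x) (subset_closure (ex_intro2 _ _ x x1 erefl)).
  rewrite -!ball_normE /= => zfx ylx; apply: (yD z Dz); rewrite -ball_normE /=.
  have lfx : `|l x - f x| < e / 4.
    rewrite -bopBE; apply: le_lt_trans lfe.
    by apply: (le_trans (le_opnorm _ _)); rewrite ler_piMr ?opnorm_ge0.
  rewrite -(subrKA (f x)) -[X in _ + X](subrKA (l x)).
  apply: (le_lt_trans (ler_normD _ _)).
  have /le_lt_trans : `|z - f x| + `|(f x - l x) + (l x - y)| <=
     `|z - f x| + (`|f x - l x| + `|l x - y|) by rewrite lerD2l ler_normD.
  apply; rewrite (distrC (f x)) (distrC (l x) y).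
  apply: (@lt_le_trans _ _ (e / 4 + (e / 4 + e / 4))).
    by do 2 (apply: ltrD => //).
  rewrite -!mulrDl ler_pdivrMr// mulr_natr -mulr2n -mulrS ler_pMn2l//.
have Up : cvg U by exact: cauchy_cvg.
exists (lim U); split=> //.
apply: (@closed_closure _ (l @` [set x | `|x| <= 1])).
by move=> N /Up UN; exact: filter_ex (filterI UA UN).
Qed.

Lemma compact_op_complete (G : set_system compact_op) :
  ProperFilter G -> cauchy G -> cvg G.
Proof.
move=> GG /cauchy_ballP cG.
pose v (f : compact_op) : bounded_op E E := f.
have cvG : cauchy (v @ G).
  apply/cauchy_ballP => e e0; rewrite near_map2.
  by have := cG _ e0; apply: filterS => -[f g] /=; rewrite -!ball_normE.
have Gl : cvg (v @ G) by exact: cauchy_cvg.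
set l := lim (v @ G) in Gl.
have lc : compact_operator l.
  apply: compact_operator_limit => e e0; near G => f; exists (v f).
    exact: compact_opP.
  by near: f; move/cvgrPdist_lt : Gl; exact.
apply/cvg_ex; exists (CompactOp (asboolT lc)); apply/cvgrPdist_lt => e e0.
by move/cvgrPdist_lt : Gl => /(_ _ e0); apply: filterS.
Unshelve. all: by end_near. Qed.

HB.instance Definition _ :=
  Uniform_isComplete.Build compact_op compact_op_complete.

Lemma bop_comp_subproof f g : bounded_operatorb (f \o g).
Proof.
apply/asboolP; split=> [a x y|]; first by rewrite /= !linearP.
exists (`|f| * `|g|) => x /=; rewrite -mulrA.
apply: (le_trans (le_opnorm _ _)); rewrite ler_wpM2l ?opnorm_ge0//.
exact: le_opnorm.
Qed.

Definition bop_comp f g : bounded_op E E := Bop (bop_comp_subproof f g).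

Lemma compact_op_comp_subproof (f g : compact_op) :
  compact_operatorb (bop_comp f g).
Proof.
apply/asboolP.
apply: (@compactW _ (f @` closure (g @` [set x | `|x| <= 1]))).
  by move=> _ [x x1 <-]; exists (g x) => //; apply: subset_closure; exists x.
apply: continuous_compact; last by rewrite -precompactE; exact: compact_opP.
by apply: continuous_subspaceT => x; exact: bop_continuous.
Qed.

Definition compact_op_comp (f g : compact_op) : compact_op :=
  CompactOp (compact_op_comp_subproof f g).

Lemma compact_opDE (f g : compact_op) x : (f + g) x = f x + g x. Proof. by []. Qed.
Lemma compact_opZE (a : K) (f : compact_op) x : (a *: f) x = a *: f x. Proof. by []. Qed.
Lemma compact_op_compE (f g : compact_op) x : compact_op_comp f g x = f (g x).
Proof. by []. Qed.

Let kext (f g : compact_op) : (forall x, f x = g x) -> f = g.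
Proof. by move=> fg; apply/val_inj/val_inj/funext. Qed.

Let kmulA (f g h : compact_op) : compact_op_comp f (compact_op_comp g h) =
  compact_op_comp (compact_op_comp f g) h.
Proof. exact: kext. Qed.
Let kmulDl (f g h : compact_op) :
  compact_op_comp (f + g) h = compact_op_comp f h + compact_op_comp g h.
Proof. by apply: kext => x; rewrite compact_opDE !compact_op_compE compact_opDE. Qed.
Let kmulDr (f g h : compact_op) :
  compact_op_comp f (g + h) = compact_op_comp f g + compact_op_comp f h.
Proof. by apply: kext => x; rewrite compact_opDE !compact_op_compE compact_opDE bop_linearD. Qed.
Let kmulZl (a : K) (f g : compact_op) :
  compact_op_comp (a *: f) g = a *: compact_op_comp f g.
Proof. by apply: kext => x; rewrite compact_opZE !compact_op_compE compact_opZE. Qed.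
Let kmulZr (a : K) (f g : compact_op) :
  compact_op_comp f (a *: g) = a *: compact_op_comp f g.
Proof. by apply: kext => x; rewrite compact_opZE !compact_op_compE compact_opZE bop_linearZ. Qed.
Let kmul_norm (f g : compact_op) : `|compact_op_comp f g| <= `|f| * `|g|.
Proof.
apply: opnorm_le => [|x]; first by rewrite mulr_ge0.
apply: (le_trans (le_opnorm (f : bounded_op E E) _)); rewrite -mulrA.
by rewrite ler_wpM2l ?opnorm_ge0//; exact: (le_opnorm (g : bounded_op E E)).
Qed.

HB.instance Definition _ := CompleteNormedModule_isBanachAlgebra.Build K
  compact_op kmulA kmulDl kmulDr kmulZl kmulZr kmul_norm.

End CompactOperators.

Definition compact_operators {K : scalarFieldType}
  (E : completeNormedModType K) : banachAlgType K := compact_op E.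

Section TopologicallyNoetherian.
Context {K : numFieldType} (A : banachAlgType K).
Implicit Types (I : set A) (x y e : A).

Definition is_unital : Prop :=
  exists e : A, forall x, bmul e x = x /\ bmul x e = x.

(* [(a, t)] stands for [a + t 1]: the whole of [A * K] is [A] with an identity
   adjoined, and when [A] is unital only the copy [A * {0}] of [A] is kept. *)
Definition unitisation : set (A * K) := [set u | is_unital -> u.2 = 0].

(* the products [u x] and [x u] in the unitisation, which belong to [A] *)
Definition unit_mull (u : A * K) x : A := bmul u.1 x + u.2 *: x.
Definition unit_mulr x (u : A * K) : A := bmul x u.1 + u.2 *: x.

Definition linear_subspace I : Prop :=
  I 0 /\ forall (a : K) x y, I x -> I y -> I (a *: x + y).

Definition left_ideal I : Prop :=
  linear_subspace I /\ forall a x, I x -> I (bmul a x).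
Definition right_ideal I : Prop :=
  linear_subspace I /\ forall a x, I x -> I (bmul x a).

Definition left_combinations n (x : 'I_n -> A) : set A :=
  [set y | exists2 u : 'I_n -> A * K, (forall i, unitisation (u i)) &
           y = \sum_(i < n) unit_mull (u i) (x i)].
Definition right_combinations n (x : 'I_n -> A) : set A :=
  [set y | exists2 u : 'I_n -> A * K, (forall i, unitisation (u i)) &
           y = \sum_(i < n) unit_mulr (x i) (u i)].

Definition topologically_left_Noetherian : Prop :=
  forall I, left_ideal I -> closed I ->
  exists n (x : 'I_n -> A),
    (forall i, I (x i)) /\ I = closure (left_combinations x).

Definition topologically_right_Noetherian : Prop :=
  forall I, right_ideal I -> closed I ->
  exists n (x : 'I_n -> A),
    (forall i, I (x i)) /\ I = closure (right_combinations x).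

End TopologicallyNoetherian.

Definition separable_space (T : topologicalType) : Prop :=
  exists2 D : set T, countable D & dense D.

Definition dual {K : scalarFieldType} (E : normedModType K) :
  normedModType K := bounded_op E K^o.

Section ApproximationProperties.
Context {K : scalarFieldType} (E : normedModType K).

Definition finite_rank (T : bounded_op E E) : Prop :=
  exists n (v : 'I_n -> E), forall x, exists c : 'I_n -> K,
    T x = \sum_(i < n) c i *: v i.

Definition approximation_property : Prop :=
  forall C : set E, compact C -> forall e : K, 0 < e ->
  exists2 T : bounded_op E E, finite_rank T & forall x, C x -> `|T x - x| < e.

Definition bounded_approximation_property : Prop :=
  exists2 M : K, 0 < M &
  forall C : set E, compact C -> forall e : K, 0 < e ->
  exists2 T : bounded_op E E, finite_rank T /\ `|T| <= M &
    forall x, C x -> `|T x - x| < e.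

End ApproximationProperties.

(* Main.v *)
Require Import Defs.
From mathcomp Require Import all_boot all_order all_algebra.
From mathcomp Require Import all_classical all_reals all_analysis.
From mathcomp Require Import finmap complex ring.

(* Since a compact [T] is a limit of operators [S T] with [S] of finite rank, a
   closed left ideal is the closed span of the rank-one operators [e (x) f] with
   [f] in a closed subspace [F] of [E']. If [E'] is separable, choose [f_n] dense
   in [F], a biorthogonal sequence [(e_n, u_n)] and small nonzero [c_n]; then
   [X = \sum_n c_n e_n (x) f_n] generates the ideal, because
   [(e (x) u_n) X = c_n e (x) f_n]. (If [E] has no biorthogonal sequence, it is
   finite-dimensional.) Conversely, generators [T_1, ..., T_n] of [K(E)] exhibit
   [E'] as the closed span of the ranges of the adjoints of the [T_i], and these
   are separable, the adjoints being compact.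

   Right ideals are dual, except for [T ~ T S]. A finite-rank [R] on [E'] that is
   close to the identity on the image of the unit ball under [T'] has the form
   [\sum_j Phi_j (x) g_j] with [Phi_j] in the bidual; as [T] is compact,
   [T'' Phi_j] is a norm limit of vectors [T x], so each [Phi_j] may be replaced
   by a point [x_j] of [E]. No bound on the norm of [S] is involved, and the
   approximation property of [E'] is enough. *)

Set Implicit Arguments.
Unset Strict Implicit.
Unset Printing Implicit Defensive.

Import Order.TTheory GRing.Theory Num.Theory.
Import numFieldNormedType.Exports.

Local Open Scope classical_set_scope.
Local Open Scope ring_scope.

(** * The Hahn-Banach theorem *)

Section RealHahnBanach.
Context (R : realType) (K : numFieldType) (i : {rmorphism R -> K}).
Context (E : lmodType K) (p : E -> R).
Hypothesis pD : forall x y, p (x + y) <= p x + p y.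
Hypothesis pZ : forall t x, 0 <= t -> p (i t *: x) = t * p x.

(** A functional on a subspace is encoded by its graph. It is linear over the reals only, these
    acting through [i], so that real and complex spaces are treated at once. Domination makes such a
    graph single-valued, because [p 0 = 0]. *)
Definition dominated_graph (G : set (E * R)) : Prop :=
  (forall t z w, G z -> G w -> G (i t *: z.1 + w.1, t * z.2 + w.2)) /\
  forall z, G z -> z.2 <= p z.1.

(** The value [c] at the new vector [v] must separate the numbers [z.2 - p (z.1 - v)] from the
    numbers [p (z.1 + v) - z.2]. Subadditivity puts the former below the latter, so their supremum
    will do; positive homogeneity then passes from [v] and [- v] to all real multiples of [v]. *)
Let one_step (G : set (E * R)) v : dominated_graph G -> G (0, 0) ->
  exists c, forall z, G z -> forall t, z.2 + t * c <= p (z.1 + i t *: v).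
Proof.
move=> [GL Gp] G0.
pose S := [set z.2 - p (z.1 - v) | z in G].
have ub z : G z -> ubound S (p (z.1 + v) - z.2).
  move=> Gz _ [w Gw <-]; rewrite lerBrDr addrAC lerBlDr.
  have := Gp _ (GL 1 _ _ Gw Gz); rewrite rmorph1 scale1r mul1r /= => /le_trans; apply.
  by have := pD (z.1 + v) (w.1 - v); rewrite addrACA subrr addr0 [z.1 + w.1]addrC.
have S0 : S !=set0 by exists (0 - p (0 - v)); exists (0, 0).
have supS : has_sup S by split=> //; exists (p (0 + v) - 0); exact: (ub _ G0).
have le_c z : G z -> z.2 + sup S <= p (z.1 + v).
  by move=> Gz; rewrite addrC -lerBrDr; apply: ge_sup => //; exact: ub.
have ge_c z : G z -> z.2 - sup S <= p (z.1 - v).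
  move=> Gz; rewrite lerBlDr addrC -lerBlDr; apply: (sup_upper_bound supS).
  by exists z.
exists (sup S) => z Gz t.
have GZ s : G (i s *: z.1, s * z.2).
  by have := GL s _ _ Gz G0; rewrite /= !addr0.
have [t0|t0|->] := ltgtP t 0; last first.
- by rewrite mul0r rmorph0 scale0r !addr0 Gp.
- have tn : t != 0 by rewrite gt_eqF.
  have := ler_wpM2l (ltW t0) (le_c _ (GZ t^-1)); rewrite /= mulrDr mulrA mulfV// mul1r.
  by rewrite -(pZ _ (ltW t0)) scalerDr scalerA -rmorphM mulfV// rmorph1 scale1r.
have nt0 : 0 < - t by rewrite oppr_gt0.
have tn : - t != 0 by rewrite gt_eqF.
have := ler_wpM2l (ltW nt0) (ge_c _ (GZ (- t)^-1)); rewrite /= mulrBr mulrA mulfV// mul1r.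
rewrite mulNr opprK -(pZ _ (ltW nt0)) scalerBr scalerA -rmorphM mulfV// rmorph1 scale1r.
by rewrite rmorphN scaleNr opprK.
Qed.

Lemma real_hahn_banach (G : set (E * R)) : dominated_graph G -> G (0, 0) ->
  exists f : E -> R, [/\ forall t x y, f (i t *: x + y) = t * f x + f y,
    forall x, f x <= p x & forall z, G z -> f z.1 = z.2].
Proof.
(* Adding [G] inside [P] makes the empty chain harmless: its union is the empty set, and [P] holds
   there by [GP]. *)
move=> GP G0; pose P (H : set (E * R)) := dominated_graph (H `|` G).
have [F FP Ftot|A [AP Amax]] := @Zorn_bigcup _ P.
  have [L|nF] := pselect (F !=set0); last first.
    suff -> : \bigcup_(X in F) X = set0 by rewrite /P set0U.
    by rewrite -subset0 => x [X FX _]; apply: nF; exists X.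
  have FU (z w : E * R) : (\bigcup_(X in F) X `|` G) z -> (\bigcup_(X in F) X `|` G) w ->
      exists X, [/\ F X, (X `|` G) z & (X `|` G) w].
    case=> [[X FX Xz]|Gz] [[Y FY Yw]|Gw].
    - have [XY|YX] := Ftot _ _ FX FY.
        by exists Y; split=> //; left=> //; exact: XY.
      by exists X; split=> //; left=> //; exact: YX.
    - by exists X; split=> //; [left|right].
    - by exists Y; split=> //; [right|left].
    - by have [X FX] := L; exists X; split=> //; right.
  split=> [t z w Fz Fw|z Fz].
    have [X [FX Xz Xw]] := FU _ _ Fz Fw.
    have [] := (FP _ FX).1 t _ _ Xz Xw; last by right.
    by left; exists X.
  by have [X [FX Xz _]] := FU _ _ Fz Fz; exact: (FP _ FX).2.
set M := A `|` G in AP; have [ML Mp] := AP.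
have M0 : M (0, 0) by right.
have Mfun x r s : M (x, r) -> M (x, s) -> r = s.
  move=> Mr Ms; have p0 : p 0 = 0 by rewrite -[0 in LHS](scale0r 0) -(rmorph0 i) pZ// mul0r.
  have le a b : M (x, a) -> M (x, b) -> a <= b.
    move=> Ma Mb; have /Mp /= := ML (- 1) _ _ Mb Ma.
    by rewrite rmorphN rmorph1 scaleN1r mulN1r addNr p0 addrC subr_le0.
  by apply/le_anti; rewrite !le.
have Mtot v : exists r, M (v, r).
  have [c cP] := one_step v AP M0; exists c; apply: contrapT => nMc.
  (* If [(v, c)] were missing from [M], the extension [H] of [M] by [v] would contradict the
     maximality of [A]. *)
  pose H := [set y | exists2 z, M z & exists t, y = (z.1 + i t *: v, z.2 + t * c)].
  have MH : M `<=` H.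
    move=> [x r] Mz; exists (x, r) => //; exists 0.
    by rewrite rmorph0 scale0r mul0r !addr0.
  apply: (Amax H); first split.
  - by move=> z Az; apply: MH; left.
  - move=> HA; apply: nMc; left; apply: HA; exists (0, 0) => //; exists 1.
    by rewrite rmorph1 scale1r mul1r !add0r.
  rewrite /P (setUidl _); last by move=> z Gz; apply: MH; right.
  split=> [t _ _ [z Mz [a ->]] [w Mw [b ->]]|_ [z Mz [a ->]]]; last exact: cP.
  exists (i t *: z.1 + w.1, t * z.2 + w.2); first exact: ML.
  exists (t * a + b); congr pair => /=.
    by rewrite rmorphD rmorphM scalerDl scalerDr -scalerA addrACA.
  by rewrite mulrDl mulrDr mulrA addrACA.
have [f fM] := boolp.choice Mtot.
exists f; split=> [t x y|x|[x r] Gz /=].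
- exact: (Mfun _ _ _ (fM _) (ML t _ _ (fM x) (fM y))).
- exact: (Mp _ (fM x)).
- by apply: (Mfun x) => //; right.
Qed.

End RealHahnBanach.

(* In the complex case the real functional [u] extending the real parts
   determines [x |-> u x - i u (i x)]; rotating [x] so that its value is
   nonnegative gives the norm bound. *)
Lemma hahn_banach (K : numFieldType) (E : normedModType K) (G : set (E * K)) :
  real_or_complex K -> G (0, 0) ->
  (forall a z w, G z -> G w -> G (a *: z.1 + w.1, a * z.2 + w.2)) ->
  (forall z, G z -> `|z.2| <= `|z.1|) ->
  exists f : E -> K, [/\ linear f, forall x, `|f x| <= `|x| &
    forall z, G z -> f z.1 = z.2].
Proof.
move=> KRC; case: KRC E G => R [] -> E G G0 GL Gn.
  have [|||f [fL fn fG]] := @real_hahn_banach R R idfun E Num.norm _ _ G _ G0.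
  - exact: ler_normD.
  - by move=> t x t0; rewrite normrZ ger0_norm.
  - split=> [|z Gz]; first exact: GL.
    exact: le_trans (ler_norm _) (Gn _ Gz).
  exists f; split=> // x; rewrite ler_norml fn andbT lerNl.
  have f0 : f 0 = 0 by have := fL (-1) 0 0; rewrite scaler0 addr0 mulN1r addNr.
  by have := fL (-1) x 0; rewrite scaleN1r mulN1r f0 !addr0 => <-; rewrite -normrN fn.
pose p (x : E) : R := complex.Re `|x|.
have pE x : `|x| = ((p x)%:C)%C by rewrite RRe_real// normr_real.
have absC (t : R) : 0 <= t -> `|t%:C%C| = t%:C%C.
  by move=> t0; rewrite ger0_norm// -[0]/(0%:C%C) lecR.
pose H := [set z : E * R | exists2 w, G w & z = (w.1, complex.Re w.2)].
have [||||u [uL up uH]] := @real_hahn_banach R R[i] (real_complex R) E p _ _ H.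
- by move=> x y; rewrite -lecR rmorphD /= -!pE; exact: ler_normD.
- move=> t x t0; apply: (@complexI R); rewrite rmorphM /= -!pE.
  by rewrite normrZ absC.
- split=> [t _ _ [z Gz ->] [w Gw ->]|_ [z Gz ->]] /=.
    exists (t%:C%C *: z.1 + w.1, t%:C%C * z.2 + w.2); first exact: GL.
    by congr pair => /=; case: z.2 w.2 => [? ?] [? ?] /=; ring.
  rewrite -lecR -pE; apply: le_trans (Gn _ Gz); apply: le_trans (normc_ge_Re _).
  by rewrite lecR ler_norm.
- by exists (0, 0).
have u0 : u 0 = 0.
  by have := uL (-1) 0 0; rewrite scaler0 addr0 mulN1r addNr.
have uD x y : u (x + y) = u x + u y.
  by have := uL 1 x y; rewrite rmorph1 scale1r mul1r.
have uZ t x : u (t%:C%C *: x) = t * u x.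
  by have := uL t x 0; rewrite u0 !addr0.
have ui a b x : u ((a +i* b)%C *: x) = a * u x + b * u ('i%C *: x).
  by rewrite [(a +i* b)%C]complexE /= scalerDl uD uZ [('i * _)%C]mulrC -scalerA uZ.
have uii a b x : u ('i%C *: ((a +i* b)%C *: x)) = a * u ('i%C *: x) - b * u x.
  by rewrite scalerA -mulNr addrC -ui; congr (u (_ *: _)); rewrite /GRing.mul /=; congr Complex; ring.
pose f (x : E) : R[i] := (u x +i* - u ('i%C *: x))%C.
have fL : linear f.
  move=> [a b] x y; rewrite /f scalerDr !uD ui uii.
  rewrite -[RHS]/(Complex (a * u x - b * - u ('i%C *: x) + u y)
    (a * - u ('i%C *: x) + b * u x + - u ('i%C *: y))).
  by congr Complex; ring.
exists f; split=> // [x|z Gz].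
  have [->|fx0] := eqVneq (f x) 0; first by rewrite normr0.
  have n0 : `|f x| != 0 by rewrite normr_eq0.
  pose a := `|f x| / f x; have a1 : `|a| = 1.
    by rewrite normrM normfV normr_id mulfV.
  have fax : f (a *: x) = `|f x|.
    have := fL a x 0; have -> : f 0 = 0 by rewrite /f scaler0 u0 oppr0.
    by rewrite !addr0 => ->; rewrite /GRing.scale /= divfK.
  have -> : `|x| = `|a *: x| by rewrite normrZ a1 mul1r.
  rewrite pE -fax -[X in X <= _](@RRe_real R) ?fax ?normr_real// -fax.
  by rewrite lecR; exact: up.
rewrite /f (uH (z.1, complex.Re z.2)) /=; last by exists z.
rewrite (uH ('i%C *: z.1, complex.Re ('i%C * z.2))) /=; last first.
  by exists ('i%C *: z.1, 'i%C * z.2) => //; have := GL 'i%C _ _ Gz G0; rewrite /= !addr0.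
by case: z.2 => a b /=; congr Complex; ring.
Qed.

(** * Real and complex scalars *)

Lemma complex_dist_lt (R : realType) (a b c d : R) (e : R) :
  `|a - c| < e / 2 -> `|b - d| < e / 2 -> `|(a +i* b)%C - (c +i* d)%C| < e%:C%C.
Proof.
move=> ac bd; have -> : (a +i* b)%C - (c +i* d)%C = (a - c)%:C%C + 'i%C * (b - d)%:C%C.
  by rewrite [LHS]complexE.
have nC (t : R) : `|t%:C%C| = `|t|%:C%C :> R[i].
  by rewrite normc_def /= expr0n addr0 sqrtr_sqr.
apply: (le_lt_trans (ler_normD _ _)); rewrite normrM.
have -> : `|'i%C| = 1 :> R[i] by rewrite normc_def /= expr0n expr1n add0r sqrtr1.
by rewrite mul1r !nC -rmorphD ltcR [e]splitr ltrD.
Qed.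

(** In the complex case the disc lies in the continuous image of a square of side [2 m]. *)
Lemma disc_subset_compact (K : numFieldType) (M : K) :
  real_or_complex K -> exists2 B : set K^o, compact B & forall z : K, `|z| <= M -> B z.
Proof.
move=> KRC; case: KRC M => R [] -> M.
  exists `[- M, M]%classic; first exact: segment_compact.
  by move=> z; rewrite ler_norml /= in_itv.
pose m := complex.Re M.
exists ((fun z : R * R => (z.1 +i* z.2)%C : R[i]^o) @` (`[- m, m] `*` `[- m, m])).
  apply: continuous_compact; last by apply: compact_setX; exact: segment_compact.
  apply: continuous_subspaceT => -[a b]; apply/cvgrPdist_lt => e e0.
  have eE : ((complex.Re e)%:C)%C = e by rewrite RRe_real// gtr0_real.
  have e20 : 0 < complex.Re e / 2 by rewrite divr_gt0// -ltcR eE.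
  have h1 : (fun z : R * R => z.1) @ nbhs (a, b) --> a by exact: cvg_fst.
  have h2 : (fun z : R * R => z.2) @ nbhs (a, b) --> b by exact: cvg_snd.
  near=> z; rewrite -eE; apply: complex_dist_lt => /=; near: z.
    by move/cvgrPdist_lt : h1; apply.
  by move/cvgrPdist_lt : h2; apply.
move=> [a b] zM; exists (a, b) => //=.
have le_m (t : R) : `|t|%:C%C <= `|(a +i* b)%C| -> t \in `[- m, m].
  move=> /le_trans /(_ zM) tM; rewrite in_itv /= -ler_norml -lecR RRe_real//.
  by apply: ger0_real; apply: le_trans zM.
split; first by rewrite /= -/(_ \in _); apply: le_m; exact: (normc_ge_Re (a +i* b)%C).
(* The imaginary part [b] is bounded through the real part of ['i * z], which is [- b]. *)
rewrite /= -/(_ \in _); apply: le_m; rewrite -normrN.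
have -> : `|(a +i* b)%C| = `|'i%C * (a +i* b)%C|.
  rewrite normrM; have -> : `|'i%C| = 1 :> R[i].
    by rewrite normc_def /= expr0n expr1n add0r sqrtr1.
  by rewrite mul1r.
by have := normc_ge_Re ('i%C * (a +i* b)%C) => /=; rewrite mul0r mul1r sub0r.
Unshelve. all: by end_near. Qed.

Lemma scalar_inv_small (K : numFieldType) (e : K) :
  real_or_complex K -> 0 < e -> exists n, n.+1%:R^-1 < e.
Proof.
have small (R : realType) (r : R) : 0 < r -> exists n, n.+1%:R^-1 < r.
  move=> r0; exists (Num.truncn r^-1); rewrite invf_plt ?posrE ?ltr0n//.
  exact: truncnS_gt.
move=> KRC; case: KRC e => R [] -> e e0; first exact: small.
have eE : ((complex.Re e)%:C)%C = e by rewrite RRe_real// gtr0_real.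
move: e0; rewrite -eE -[0]/(0%:C%C) ltcR => /small[n ne]; exists n.
by rewrite -(rmorph_nat (real_complex R)) -fmorphV ltcR.
Qed.

Lemma scalar_dense_seq (K : numFieldType) : real_or_complex K ->
  exists q : nat -> K, forall a e, 0 < e -> exists n, `|a - q n| < e.
Proof.
have ratd (R : realType) (a e : R) : 0 < e -> exists r : rat, `|a - ratr r| < e.
  move=> e0; have /rat_in_itvoo[r] : a - e < a + e by rewrite ltrD2l gtrN.
  rewrite in_itv /= => /andP[ae ea]; exists r.
  by rewrite distrC ltr_distl ae ea.
case=> R [] ->.
  exists (fun n => ratr (odflt 0 (choice.unpickle n : option rat))) => a e e0.
  by have [r ar] := ratd _ a e e0; exists (choice.pickle r); rewrite choice.pickleK.
exists (fun n => let: (r, s) := odflt (0, 0) (choice.unpickle n : option (rat * rat)) in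
  (ratr r +i* ratr s)%C) => -[a b] e e0.
have eE : ((complex.Re e)%:C)%C = e by rewrite RRe_real// gtr0_real.
have e20 : 0 < complex.Re e / 2 by rewrite divr_gt0// -ltcR eE.
have [r ar] := ratd _ a _ e20; have [s bs] := ratd _ b _ e20.
exists (choice.pickle (r, s)); rewrite choice.pickleK /= -eE.
exact: complex_dist_lt.
Qed.

(** * Separability *)

Section Separability.
Context {K : scalarFieldType}.
Implicit Types V : normedModType K.

(** The points [u n] may lie outside [S], so the property passes to subsets without further
    choices. *)
Definition countably_approximable V (S : set V) : Prop :=
  exists u : nat -> V, forall x, S x -> forall e : K, 0 < e ->
    exists n, `|x - u n| < e.

Lemma separable_countably_approximable V :
  separable_space V <-> countably_approximable [set: V].
Proof.
split=> [[D cD dD]|[u uP]].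
  have [y [_ Dy]] : setT `&` D !=set0.
    by apply: dD openT; exists 0.
  have /pfcard_geP[D0|[f]] := cD; first by rewrite D0 in Dy.
  exists f => x _ e e0.
  have [z [xz /(@surj _ _ _ _ f)[n _ fn]]] : ball x e `&` D !=set0.
    by apply: dD; [exists x; exact: ballxx|exact: ball_open].
  by exists n; rewrite fn; move: xz; rewrite -ball_normE.
exists (range u); first exact: card_image_le.
move=> O [x Ox] oO.
have /nbhs_ballP[e /= e0 eO] : nbhs x O by exact: open_nbhs_nbhs.
have [n xn] := uP x I e e0.
by exists (u n); split; [apply: eO; rewrite -ball_normE|exists n].
Qed.

Lemma countably_approximable_sub V (S S' : set V) :
  S `<=` S' -> countably_approximable S' -> countably_approximable S.
Proof. by move=> SS' [u uP]; exists u => x /SS'; exact: uP. Qed.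

(** For each [n] and [k], a point of [S] at distance less than [1 / (k + 1)] from [u n] is selected
    if there is one, and the default [y] otherwise. Passing through [u n] costs this distance twice,
    hence the choice of [k] from [e / 2]. *)
Lemma countably_approximable_inner V (S : set V) y : S y ->
  countably_approximable S -> exists u : nat -> V,
    (forall n, S (u n)) /\
    forall x, S x -> forall e : K, 0 < e -> exists n, `|x - u n| < e.
Proof.
move=> Sy [u uP].
pose P (k : nat * nat) z := S z /\ `|z - u k.1| < k.2.+1%:R^-1.
have /boolp.choice[v vP] k : exists z, S z /\ ((exists z', P k z') -> P k z).
  have [[z Pz]|nP] := pselect (exists z, P k z); first by exists z; split=> //; case: Pz.
  by exists y; split.
exists (fun n => v (odflt (0, 0)%N (choice.unpickle n))); split=> [n|x Sx e e0].
  exact: (vP _).1.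
have [k ke] := scalar_inv_small (scalarFieldP K) (divr_gt0 e0 (ltr0n K 2)).
have k0 : 0 < k.+1%:R^-1 :> K by rewrite invr_gt0 ltr0n.
have [n xn] := uP x Sx _ k0.
exists (choice.pickle (n, k)); rewrite choice.pickleK /=.
have [_ /= vn] := (vP (n, k)).2 (ex_intro _ x (conj Sx xn)).
rewrite -(subrKA (u n)) (le_lt_trans (ler_normD _ _))// (splitr e).
by rewrite ltrD ?(lt_trans xn)// distrC (lt_trans vn).
Qed.

Lemma compact_net V (S : set V) (e : K) : compact S -> 0 < e ->
  exists n (y : 'I_n -> V), (forall i, S (y i)) /\
    forall x, S x -> exists i, `|x - y i| < e.
Proof.
rewrite compact_cover => cS e0.
have [|x Sx|D DS Dcov] := cS V S (fun y => ball y e).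
- by move=> y _; exact: ball_open.
- by exists x => //; exact: ballxx.
exists (size (enum_fset D)), (tnth (in_tuple (enum_fset D))); split=> [i|x Sx].
  by apply/set_mem/DS; rewrite mem_tnth.
have [y /= yD xy] := Dcov _ Sx.
have /tnthP[i yi] : y \in in_tuple (enum_fset D) by [].
by exists i; rewrite -yi distrC; move: xy; rewrite -ball_normE.
Qed.

Lemma compact_countably_approximable V (S : set V) :
  compact S -> countably_approximable S.
Proof.
move=> cS.
have /boolp.choice[s sP] k : exists s : seq V,
    forall x, S x -> exists2 y, y \in s & `|x - y| < k.+1%:R^-1.
  have [|n [y [_ yP]]] := @compact_net _ _ k.+1%:R^-1 cS.
    by rewrite invr_gt0 ltr0n.
  exists (codom y) => x /yP[i xi]; exists (y i) => //; exact: codom_f.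
exists (fun n => let: (k, j) := odflt (0, 0)%N (choice.unpickle n) in nth 0 (s k) j).
move=> x Sx e e0.
have [k ke] := scalar_inv_small (scalarFieldP K) e0.
have [y ys xy] := sP k x Sx; exists (choice.pickle (k, index y (s k))).
by rewrite choice.pickleK /= nth_index// (lt_trans xy).
Qed.

(** The number [n] of summands is fixed, so combinations with coefficients from a countable dense
    set of scalars and vectors from the approximating sequences are indexed by the countable type of
    finite functions on ['I_n]. *)
Lemma separable_of_span V n (S : 'I_n -> set V) :
  (forall i, countably_approximable (S i)) ->
  (forall x (e : K), 0 < e -> exists (c : 'I_n -> K) (s : 'I_n -> V),
     (forall i, S i (s i)) /\ `|x - \sum_(i < n) c i *: s i| < e) ->
  separable_space V.
Proof.
move=> /boolp.choice[u uP] xP; apply/separable_countably_approximable.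
have [q qP] := scalar_dense_seq (scalarFieldP K).
pose v (w : {ffun 'I_n -> nat * nat}) := \sum_(i < n) q (w i).1 *: u i (w i).2.
exists (fun k => v (odflt [ffun=> (0, 0)%N] (choice.unpickle k))) => x _ e e0.
have e20 : 0 < e / 2 by rewrite divr_gt0.
have [c [s [Ss xs]]] := xP x _ e20.
(* The [n] errors below [d] add up to at most [e / 2]; dividing by [n.+1] also covers [n = 0]. *)
pose d := e / 2 / n.+1%:R; have d0 : 0 < d by rewrite divr_gt0.
have /boolp.choice[w wP] i : exists w : nat * nat, `|c i *: s i - q w.1 *: u i w.2| < d.
  have d20 : 0 < d / 2 by rewrite divr_gt0.
  have s0 : 0 < 1 + `|s i| by rewrite ltr_pwDl.
  (* The scalar is chosen before the vector, since the tolerance for the vector depends on [q a]. *)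
  have [a ca] := qP (c i) _ (divr_gt0 d20 s0).
  have q0 : 0 < 1 + `|q a| by rewrite ltr_pwDl.
  have [b sb] := uP i (s i) (Ss i) _ (divr_gt0 d20 q0).
  exists (a, b) => /=; rewrite -(subrKA (q a *: s i)) -scalerBl -scalerBr.
  rewrite (le_lt_trans (ler_normD _ _))// (splitr d) !normrZ ltrD//.
    rewrite ltr_pdivlMr// in ca; apply: le_lt_trans ca.
    by rewrite ler_wpM2l// lerDr.
  rewrite ltr_pdivlMr// mulrC in sb; apply: le_lt_trans sb.
  by rewrite ler_wpM2r// lerDr.
exists (choice.pickle [ffun i => w i]); rewrite choice.pickleK /= /v.
under eq_bigr do rewrite ffunE.
rewrite -(subrKA (\sum_(i < n) c i *: s i)) (le_lt_trans (ler_normD _ _))//.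
rewrite (splitr e) ltr_leD// -sumrB (le_trans (ler_norm_sum _ _ _))//.
rewrite (le_trans (ler_sum _ (fun i _ => ltW (wP i))))// sumr_const card_ord -[d *+ n]mulr_natr.
by rewrite /d -mulrA ler_piMr ?(ltW e20)// mulrC ler_pdivrMr// mul1r ler_nat.
Qed.

End Separability.

(** * Bounded functionals *)

Local Notation functional E := (bounded_op E (_^o)).

Section Span.
Context {K : fieldType} {V : lmodType K}.
Implicit Types (x y : V) (v : seq V).

(** Coefficients are peeled off one at a time, which suits inductions that remove a vector from the
    spanning list. *)
Fixpoint in_span v x : Prop :=
  if v is a :: v' then exists c : K, in_span v' (x - c *: a) else x = 0.

Lemma in_span_sum (T : Type) (r : seq T) (v : T -> V) (c : T -> K) :
  in_span (map v r) (\sum_(i <- r) c i *: v i).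
Proof.
elim: r => [|i s IH] /=; first by rewrite big_nil.
by rewrite big_cons; exists (c i); rewrite addrC addKr.
Qed.

Lemma in_span_linear (L : V -> V) v x :
  linear L -> in_span v x -> in_span (map L v) (L x).
Proof.
move=> LL; elim: v x => [x ->|a v IH x [c /IH]] /=.
  by have := LL (-1) 0 0; rewrite scaler0 addr0 scaleN1r addNr.
by rewrite -scaleNr addrC LL scaleNr addrC; exists c.
Qed.

Lemma in_span0 v : in_span v 0.
Proof. by elim: v => [//|b v IH] /=; exists 0; rewrite scale0r subr0. Qed.

Lemma in_spanP v c x y : in_span v x -> in_span v y -> in_span v (c *: x + y).
Proof.
elim: v x y => [x y -> ->|b v IH x y [cx sx] [cy sy]] /=.
  by rewrite scaler0 addr0.
exists (c * cx + cy); have := IH _ _ sx sy; congr in_span.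
by rewrite scalerBr scalerA scalerDl opprD addrACA.
Qed.

End Span.

Section FunctionalValue.
Context {K : scalarFieldType} (E : normedModType K).
Implicit Types (x y : E) (f g h : functional E).

Definition fval f x : K := f x.

Lemma fvalD f x y : fval f (x + y) = fval f x + fval f y.
Proof. exact (bop_linearD f x y). Qed.
Lemma fvalB f x y : fval f (x - y) = fval f x - fval f y.
Proof. exact (linearB f x y). Qed.
Lemma fvalZ f a x : fval f (a *: x) = a * fval f x.
Proof. exact (bop_linearZ f a x). Qed.
Lemma fval_sum f I (r : seq I) (P : pred I) (x : I -> E) :
  fval f (\sum_(j <- r | P j) x j) = \sum_(j <- r | P j) fval f (x j).
Proof. exact (linear_sum f _ _ _). Qed.
Lemma fvalDl f g x : fval (f + g) x = fval f x + fval g x. Proof. by []. Qed.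
Lemma fvalBl f g x : fval (f - g) x = fval f x - fval g x. Proof. by []. Qed.
Lemma fvalZl a f x : fval (a *: f) x = a * fval f x. Proof. by []. Qed.
Lemma fval_suml I (r : seq I) (P : pred I) (f : I -> functional E) x :
  fval (\sum_(j <- r | P j) f j) x = \sum_(j <- r | P j) fval (f j) x.
Proof. by apply: (big_morph (fval^~ x)). Qed.
Lemma fval_le f x : `|fval f x| <= `|f| * `|x|.
Proof. exact: le_opnorm. Qed.

Lemma functional_ext f g : (forall x, fval f x = fval g x) -> f = g.
Proof. by move=> fg; apply/val_inj/funext. Qed.

Lemma functional_norm_le f (M : K) :
  0 <= M -> (forall x, `|fval f x| <= M * `|x|) -> `|f| <= M.
Proof. exact: opnorm_le. Qed.

Lemma functional_of_linear (u : E -> K) (M : K) :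
  (forall a x y, u (a *: x + y) = a * u x + u y) ->
  (forall x, `|u x| <= M * `|x|) -> exists f, forall x, fval f x = u x.
Proof.
move=> uL uM; have ub : bounded_operator (u : E -> K^o) by split=> //; exists M.
by exists (Bop (asboolT ub)).
Qed.

End FunctionalValue.

Arguments fval : simpl never.

Section Functionals.
Context {K : scalarFieldType} (E : normedModType K).
Implicit Types (x y : E) (f g h : functional E).

Lemma functional_extension (G : set (E * K)) : G (0, 0) ->
  (forall a z w, G z -> G w -> G (a *: z.1 + w.1, a * z.2 + w.2)) ->
  (forall z, G z -> `|z.2| <= `|z.1|) ->
  exists f, (forall x, `|fval f x| <= `|x|) /\ forall z, G z -> fval f z.1 = z.2.
Proof.
move=> G0 GL Gn; have [u [uL un uG]] := hahn_banach (scalarFieldP K) G0 GL Gn.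
have [|f fE] := @functional_of_linear _ _ u 1 uL.
  by move=> x; rewrite mul1r.
by exists f; split=> [x|z Gz]; rewrite fE//; exact: uG.
Qed.

Lemma norming_functional x :
  exists f, (forall y, `|fval f y| <= `|y|) /\ fval f x = `|x|.
Proof.
pose G := [set z : E * K | exists a, z = (a *: x, a * `|x|)].
have [|||f [fn fG]] := @functional_extension G.
- by exists 0; rewrite scale0r mul0r.
- move=> a _ _ [b ->] [c ->]; exists (a * b + c).
  by rewrite /= scalerDl mulrDl scalerA mulrA.
- by move=> _ [a ->] /=; rewrite normrM normr_id normrZ.
by exists f; split=> //; apply: (fG (x, `|x|)); exists 1; rewrite scale1r mul1r.
Qed.

Lemma separating_functional x : x != 0 -> exists f, fval f x = 1.
Proof.
move=> x0; have [f [_ fx]] := norming_functional x.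
by exists (`|x|^-1 *: f); rewrite fvalZl fx mulVf// normr_eq0.
Qed.

Lemma rank_one_bounded (e : E) f : bounded_operatorb (fun x => fval f x *: e).
Proof.
apply/asboolP; split=> [a x y|].
  by rewrite fvalD fvalZ scalerDl scalerA.
exists (`|f| * `|e|) => x; rewrite normrZ mulrAC ler_wpM2r//; exact: fval_le.
Qed.

Definition rank_one_bop e f : bounded_op E E := Bop (rank_one_bounded e f).

Lemma functional_comp_bounded f (S : bounded_op E E) :
  bounded_operatorb (fun x => fval f (S x) : K^o).
Proof.
apply/asboolP; split=> [a x y|]; first by rewrite linearP fvalD fvalZ.
exists (`|f| * `|S|) => x; apply: (le_trans (fval_le _ _)).
by rewrite -mulrA ler_wpM2l//; exact: le_opnorm.
Qed.

Definition functional_comp f (S : bounded_op E E) : functional E :=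
  Bop (functional_comp_bounded f S).

Lemma functional_compE f (S : bounded_op E E) x :
  fval (functional_comp f S) x = fval f (S x).
Proof. by []. Qed.

(* Subtracting [psi (S x) a] with [psi a = 1] from [S x] removes the vector [a]
   from the spanning family while keeping the coefficients bounded. *)
Lemma finite_rank_sum (S : bounded_op E E) : finite_rank S ->
  exists s : seq (functional E * E),
    forall x, S x = \sum_(p <- s) fval p.1 x *: p.2.
Proof.
move=> [n [v Sv]]; have {Sv} : forall x, in_span (map v (index_enum 'I_n)) (S x).
  by move=> x; have [c ->] := Sv x; exact: in_span_sum.
move: (map _ _) => {n}v; have [n] := ubnP (size v).
elim: n v S => [//|n IH] [|a v] S /= vn Sv.
  by exists [::] => x; rewrite big_nil; exact: Sv.
pose L f : E -> E := fun x => x - fval f x *: a.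
have LL f : linear (L f).
  move=> c x y; rewrite /L fvalD fvalZ scalerDl opprD scalerBr scalerA.
  by rewrite addrACA.
have [f fa] : exists f, L f a = 0.
  have [a0|/separating_functional[f fa]] := eqVneq a 0.
    by exists 0; rewrite /L a0 scaler0 subr0.
  by exists f; rewrite /L fa scale1r subrr.
have [|x|s sS] := IH (map (L f) v) (S - rank_one_bop a (functional_comp f S)).
- by rewrite size_map.
- have [c /(in_span_linear (LL f))] := Sv x.
  by rewrite -scaleNr addrC LL fa scaler0 add0r.
exists ((functional_comp f S, a) :: s) => x; rewrite big_cons /= -sS.
by rewrite addrC bopBE subrK.
Qed.

(** Gaussian elimination: if [f] leaves a nonzero remainder [r], the list [t] is extended by [r] and
    a point [z'] at which [f] takes the value 1 and all elements of [s] vanish. *)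
Lemma interpolation (s : seq (functional E)) :
  exists t : seq (E * functional E), forall f, f \in s ->
    f = \sum_(p <- t) fval f p.1 *: p.2.
Proof.
elim: s => [|f s [t tP]]; first by exists [::].
pose r := f - \sum_(p <- t) fval f p.1 *: p.2.
have [r0|/eqP r0] := pselect (r = 0).
  exists t => h; rewrite inE => /predU1P[->|/tP//].
  by apply/eqP; rewrite -subr_eq0 -/r r0.
have [z rz] : exists z, fval r z = 1.
  apply: contrapT => /forallNP nz; apply: (negP r0).
  apply/eqP/functional_ext => x; apply: contrapT => /eqP rx.
  by apply: (nz ((fval r x)^-1 *: x)); rewrite fvalZ mulVf.
pose z' := z - \sum_(p <- t) fval p.2 z *: p.1.
have fz' h : fval h z' = fval (h - \sum_(p <- t) fval h p.1 *: p.2) z.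
  rewrite fvalB fvalBl fval_sum fval_suml; congr (_ - _).
  by apply: eq_bigr => p _; rewrite fvalZ fvalZl mulrC.
exists ((z', r) :: t) => h; rewrite inE big_cons /= fz' => /predU1P[->|hs].
  by rewrite rz scale1r subrK.
by rewrite -tP// subrr scale0r add0r.
Qed.

(* The functional [n + t x0 |-> t (|Phi| + 1)] on the span of [x0] and the
   common kernel of [s] cannot be dominated by the norm: its extension would be
   a combination of elements of [s]. *)
Lemma helly (Phi : functional (functional E)) (s : seq (functional E)) :
  exists x, `|x| <= `|Phi| + 1 /\ forall f, f \in s -> fval f x = fval Phi f.
Proof.
have [t tP] := interpolation s.
(* The point [x0] already has the prescribed values on [s], but its norm is not controlled. *)
pose x0 := \sum_(p <- t) fval Phi p.2 *: p.1.
have fx0 f : f \in s -> fval f x0 = fval Phi f.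
  move=> /tP fE; rewrite [in RHS]fE !fval_sum.
  by apply: eq_bigr => p _; rewrite !fvalZ mulrC.
pose N := [set n : E | forall f, f \in s -> fval f n = 0].
apply: contrapT => /forallNP nx; pose C := `|Phi| + 1.
have C0 : 0 <= C by rewrite addr_ge0.
have Cx n : N n -> C <= `|x0 + n|.
  move=> Nn; rewrite real_leNgt ?normr_real ?ger0_real//; apply/negP => /ltW xC.
  by apply: (nx (x0 + n)); split=> // f fs; rewrite fvalD Nn// addr0 fx0.
pose G := [set z : E * K | exists a n, N n /\ z = (a *: x0 + n, a * C)].
have [|||g [gn gG]] := @functional_extension G.
- exists 0, 0; split; last by rewrite scale0r mul0r addr0.
  by move=> f _; have := fvalB f 0 0; rewrite subr0 subrr.
- move=> a _ _ [b [n [Nn ->]]] [c [m [Nm ->]]]; exists (a * b + c), (a *: n + m).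
  split=> [f fs|/=]; first by rewrite fvalD fvalZ Nn// Nm// mulr0 addr0.
  by rewrite scalerDr scalerDl scalerA addrACA mulrDl mulrA.
- move=> _ [a [n [Nn ->]]] /=; rewrite normrM (ger0_norm C0).
  have [->|a0] := eqVneq a 0; first by rewrite normr0 mul0r.
  have -> : a *: x0 + n = a *: (x0 + a^-1 *: n).
    by rewrite scalerDr scalerA mulfV// scale1r.
  rewrite normrZ ler_wpM2l//; apply: Cx => f fs.
  by rewrite fvalZ Nn// mulr0.
have gx0 : fval g x0 = C.
  have /gG : G (x0, C); last by [].
  exists 1, 0; split; last by rewrite scale1r mul1r addr0.
  by move=> f _; have := fvalB f 0 0; rewrite subr0 subrr.
(* The interpolation error of any [x] lies in [N], where [g] vanishes. *)
have gE : g = \sum_(p <- t) fval g p.1 *: p.2.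
  apply: functional_ext => x; rewrite fval_suml.
  have /gG /= : G (x - \sum_(p <- t) fval p.2 x *: p.1, 0).
    exists 0, (x - \sum_(p <- t) fval p.2 x *: p.1); split; last first.
      by rewrite scale0r mul0r add0r.
    move=> f /tP fE; rewrite fvalB fval_sum {1}fE fval_suml -sumrB big1// => p _.
    by rewrite fvalZ fvalZl mulrC subrr.
  rewrite fvalB fval_sum => /eqP; rewrite subr_eq0 => /eqP ->.
  by apply: eq_bigr => p _; rewrite fvalZ mulrC.
(* Contradiction: [Phi g = g x0] equals [|Phi| + 1], although [g] has norm at most 1. *)
have Pg : fval Phi g = C.
  rewrite -gx0 {1}gE !fval_sum; apply: eq_bigr => p _.
  by rewrite !fvalZ mulrC.
have g1 : `|g| <= 1 by apply: functional_norm_le => // x; rewrite mul1r.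
have : C <= `|Phi|.
  rewrite -[C](ger0_norm C0) -Pg (le_trans (fval_le _ _))//.
  by rewrite -[leRHS]mulr1 ler_wpM2l.
by rewrite /C gerDl ler10.
Qed.

Definition biorthogonal_sequence (e : nat -> E) (u : nat -> functional E) : Prop :=
  forall n m, fval (u n) (e m) = (n == m)%:R.

(* [P x = \sum_(p <- t) p.2 x *: p.1] is a projection onto the span of the first
   components of [t], through which the second components factor. *)
Let biorthogonal_seq (t : seq (E * functional E)) :=
  forall p, p \in t -> p.1 = \sum_(q <- t) fval q.2 p.1 *: q.1 /\
    forall x, fval p.2 x = \sum_(q <- t) fval q.2 x * fval p.2 q.1.

(** As long as the projection [P] attached to the list [t] is not the identity, some [a = y - P y]
    is nonzero. A functional [h] with [h a = 1], replaced by [g = h o (1 - P)], gives a pair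
    [(a, g)] that is biorthogonal to [t]. If no finite list gives the identity, this never stops. *)
Lemma finite_basis_or_biorthogonal :
  (exists t : seq (E * functional E), forall x, x = \sum_(p <- t) fval p.2 x *: p.1) \/
  (exists e u, biorthogonal_sequence e u).
Proof.
have [|nfin] := pselect (exists t : seq (E * functional E),
    forall x, x = \sum_(p <- t) fval p.2 x *: p.1); first by left.
right; pose ok t (p : E * functional E) := [/\ biorthogonal_seq (p :: t),
  fval p.2 p.1 = 1 & forall q, q \in t -> fval q.2 p.1 = 0 /\ fval p.2 q.1 = 0].
have step t : exists p, biorthogonal_seq t -> ok t p.
  (* The pair [(0, 0)] is a dummy that makes the choice function total on lists. *)
  have [tP|] := pselect (biorthogonal_seq t); last by exists (0, 0).
  pose P x := \sum_(q <- t) fval q.2 x *: q.1.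
  have [y /eqP ny] : exists y, y != P y.
    apply: contrapT => /forallNP ny; apply: nfin; exists t => x.
    by apply/eqP/negPn/negP; exact: ny.
  have [|h ha] := @separating_functional (y - P y).
    by rewrite subr_eq0; apply/eqP.
  set a := y - P y in ha.
  pose g := h - \sum_(q <- t) fval h q.1 *: q.2.
  have gE x : fval g x = fval h (x - P x).
    rewrite fvalBl fvalB fval_suml /P fval_sum; congr (_ - _).
    by apply: eq_bigr => q _; rewrite fvalZ fvalZl mulrC.
  have tP2 p : p \in t -> forall x, fval p.2 (P x) = fval p.2 x.
    move=> pt x; rewrite [RHS](tP _ pt).2 fval_sum.
    by apply: eq_bigr => q _; rewrite fvalZ.
  have ta p : p \in t -> fval p.2 a = 0 by move=> pt; rewrite fvalB tP2// subrr.
  have gt p : p \in t -> fval g p.1 = 0.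
    move=> pt; rewrite gE -[P _](tP _ pt).1 subrr.
    by have := fvalB h 0 0; rewrite !subr0 subrr.
  have Pa : P a = 0 by rewrite /P big1_seq// => q /andP[_ /ta ->]; rewrite scale0r.
  have ga : fval g a = 1 by rewrite gE Pa subr0.
  exists (a, g) => _; split=> //; last by move=> q qt; rewrite ta// gt.
  move=> p; rewrite inE => /predU1P[->|pt] /=; split=> [|x]; rewrite big_cons /=.
  - by rewrite ga scale1r -/(P a) Pa addr0.
  - by rewrite ga mulr1 big1_seq ?addr0// => q /andP[_ /gt ->]; rewrite mulr0.
  - by rewrite gt// scale0r add0r; exact: (tP _ pt).1.
  - by rewrite ta// mulr0 add0r; exact: (tP _ pt).2.
have [next nextP] := boolp.choice step.
(* The list [s n] holds the first [n] pairs, the latest in front; the next pair is the one of index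
   [n]. *)
pose s n := iter n (fun t => next t :: t) [::].
have sP n : biorthogonal_seq (s n) by elim: n => [//|n /nextP[]].
have sS n m : (n < m)%N -> next (s n) \in s m.
  elim: m => [//|m IH]; rewrite ltnS leq_eqVlt => /predU1P[->|/IH nm].
    exact: mem_head.
  by rewrite inE nm orbT.
exists (fun n => (next (s n)).1), (fun n => (next (s n)).2) => n m.
have [nm|mn|->] := ltngtP n m.
- by have [_ _ /(_ _ (sS _ _ nm))[]] := nextP _ (sP m).
- by have [_ _ /(_ _ (sS _ _ mn))[]] := nextP _ (sP n).
- by have [] := nextP _ (sP m).
Qed.

End Functionals.

(** * Compact operators *)

Section NormedModules.
Context {K : scalarFieldType}.

Lemma opnorm_ball_le (E F : normedModType K) (f : bounded_op E F) (M : K) :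
  0 <= M -> (forall x, `|x| <= 1 -> `|f x| <= M) -> `|f| <= M.
Proof.
move=> M0 fM; apply: opnorm_le => // x.
have [->|x0] := eqVneq x 0; first by rewrite linear0 !normr0 mulr0.
have xgt0 : 0 < `|x| by rewrite normr_gt0.
have -> : f x = `|x| *: f (`|x|^-1 *: x).
  by rewrite linearZ scalerA mulfV ?gt_eqF// scale1r.
rewrite normrZ normr_id mulrC ler_wpM2r//; apply: fM.
by rewrite normrZ normfV normr_id mulVf// gt_eqF.
Qed.

Lemma closure_normP (V : normedModType K) (S : set V) x :
  closure S x <-> forall e : K, 0 < e -> exists2 y, S y & `|x - y| < e.
Proof.
split=> [Sx e e0|xS B /nbhs_ballP[e /= e0 eB]].
  have [y [Sy]] := Sx _ (nbhsx_ballx x e e0).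
  by rewrite -ball_normE; exists y.
have [y Sy xy] := xS e e0; exists y; split=> //; apply: eB.
by rewrite -ball_normE.
Qed.

Lemma precompact_net (V : normedModType K) (S : set V) (e : K) :
  precompact S -> 0 < e -> exists n (y : 'I_n -> V), (forall i, S (y i)) /\
    forall x, S x -> exists i, `|x - y i| < e.
Proof.
rewrite precompactE => cS e0; have e20 : 0 < e / 2 by rewrite divr_gt0.
have [n [y [Sy yP]]] := compact_net cS e20.
have /boolp.choice[z zP] i : exists z, S z /\ `|y i - z| < e / 2.
  by have [z] := (closure_normP _ _).1 (Sy i) _ e20; exists z.
exists n, z; split=> [i|x Sx]; first exact: (zP i).1.
have [i xi] := yP x (subset_closure Sx); exists i.
by rewrite -(subrKA (y i)) (le_lt_trans (ler_normD _ _))// (splitr e) ltrD// (zP i).2.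
Qed.

Lemma precompact_countably_approximable (V : normedModType K) (S : set V) :
  precompact S -> countably_approximable S.
Proof.
rewrite precompactE => /compact_countably_approximable.
exact/countably_approximable_sub/subset_closure.
Qed.

(** The factor [1 + |y n|] in the denominator gives [|c n *: y n| <= 2 ^- n], so the series is
    dominated by a geometric one. *)
Lemma exists_convergent_scaling (V : completeNormedModType K) (y : nat -> V) :
  exists c : nat -> K, (forall n, c n != 0) /\
    cvgn (fun N => \sum_(n < N) c n *: y n).
Proof.
pose c n : K := 2 ^- n / (1 + `|y n|).
have y0 n : 0 < 1 + `|y n| by rewrite ltr_pwDl.
have p0 n : 0 < 2 ^- n :> K by rewrite invr_gt0 exprn_gt0.
exists c; split=> [n|]; first by rewrite gt_eqF// divr_gt0.
set S := fun N => _.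
have cy n : `|c n *: y n| <= 2 ^- n.
  rewrite normrZ gtr0_norm ?divr_gt0// -mulrA ler_piMr ?(ltW (p0 n))//.
  by rewrite mulrC ler_pdivrMr// mul1r lerDr.
(* The bound is the sum of [2 ^- j] over [n <= j < n + k], written in closed form for the
   induction. *)
have SD n k : `|S (n + k)%N - S n| <= 2 * 2 ^- n - 2 * 2 ^- (n + k).
  elim: k => [|k IH]; first by rewrite addn0 !subrr normr0.
  have -> : S (n + k.+1)%N - S n = S (n + k)%N - S n + c (n + k)%N *: y (n + k)%N.
    by rewrite /S addnS big_ord_recr /= addrAC.
  apply: (le_trans (ler_normD _ _)); apply: (le_trans (lerD IH (cy _))).
  rewrite addnS exprS invfM mulrA mulfV ?pnatr_eq0// mul1r.
  by rewrite -addrA lerD2l mulr_natl mulr2n opprD addrNK.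
have Sn n m : (n <= m)%N -> `|S m - S n| <= 2 * 2 ^- n.
  move=> /subnKC <-; apply: (le_trans (SD _ _)).
  by rewrite gerBl mulr_ge0// ltW.
apply: cauchy_cvg; apply/cauchy_ballP => e e0; rewrite near_map2.
have [N Ne] : exists N, 2 * 2 ^- N < e / 2.
  have [N Ne] := scalar_inv_small (scalarFieldP K) (divr_gt0 e0 (ltr0n K 4)).
  exists N; apply: (@le_lt_trans _ _ (2 * N.+1%:R^-1)).
    rewrite ler_wpM2l// lef_pV2 ?posrE ?ltr0n ?exprn_gt0//.
    by rewrite -natrX ler_nat ltn_expl.
  by rewrite -ltr_pdivlMl// mulrC -mulrA -invfM -natrM.
near=> n m; rewrite -ball_normE /=.
rewrite -(subrKA (S N)) (le_lt_trans (ler_normD _ _))// (splitr e) ltrD//.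
  by apply: le_lt_trans Ne; apply: Sn; near: n; exact: nbhs_infty_ge.
by rewrite distrC; apply: le_lt_trans Ne; apply: Sn; near: m; exact: nbhs_infty_ge.
Unshelve. all: by end_near. Qed.

End NormedModules.

Lemma ultra_fmap (T T' : Type) (f : T -> T') (U : set_system T) :
  UltraFilter U -> UltraFilter (f @ U).
Proof.
move=> UU; split=> [|G GG UG]; first exact: fmap_proper_filter.
apply/seteqP; split=> [A GA|]; last exact: UG.
have [//|UA] := in_ultra_setVsetC (f @^-1` A) UU.
have := filter_ex (filterI GA (UG (~` A) UA)).
by move=> [y []].
Qed.

(** * Rank-one operators and the adjoint image of the dual ball *)

Section RankOne.
Context {K : scalarFieldType} (E : completeNormedModType K).
Implicit Types (x y : E) (f g h : functional E) (S T : compact_op E).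

Lemma compact_op_ext S T : (forall x, S x = T x) -> S = T.
Proof. by move=> ST; apply/val_inj/val_inj/funext. Qed.

Lemma compact_op_le T x : `|T x| <= `|T| * `|x|.
Proof. exact: (le_opnorm (T : bounded_op E E)). Qed.

Lemma compact_op_ball_le T (M : K) :
  0 <= M -> (forall x, `|x| <= 1 -> `|T x| <= M) -> `|T| <= M.
Proof. exact: opnorm_ball_le. Qed.

Lemma compact_op_linearB T x y : T (x - y) = T x - T y.
Proof. exact (linearB (T : bounded_op E E) x y). Qed.

Lemma compact_op_subE S T x : (S - T) x = S x - T x.
Proof. by []. Qed.

Lemma compact_op_sumE I (r : seq I) (P : pred I) (S : I -> compact_op E) x :
  (\sum_(j <- r | P j) S j) x = \sum_(j <- r | P j) S j x.
Proof. by apply: (big_morph (fun T : compact_op E => T x)). Qed.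

Lemma rank_one_compact (e : E) f : compact_operatorb (rank_one_bop e f).
Proof.
apply/asboolP.
have [B cB Bf] := disc_subset_compact `|f| (scalarFieldP K).
apply: (@precompact_subset _ _ ((fun c : K^o => (c : K) *: e) @` B)).
  move=> _ [x x1 <-]; exists (fval f x) => //; apply: Bf.
  by apply: (le_trans (fval_le _ _)); rewrite ler_piMr.
apply: compact_precompact; first exact: norm_hausdorff.
apply: continuous_compact => //; apply: continuous_subspaceT => c.
exact (@scalel_continuous K E e c).
Qed.

Definition rank_one (e : E) f : compact_op E := CompactOp (rank_one_compact e f).

Lemma rank_oneE e f x : rank_one e f x = fval f x *: e.
Proof. by []. Qed.

Lemma scale_rank_oneE (c : K) e f x : (c *: rank_one e f) x = (c * fval f x) *: e.
Proof. by rewrite -scalerA. Qed.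

Lemma rank_one_norm e f : `|rank_one e f| <= `|e| * `|f|.
Proof.
apply: opnorm_le => [|x]; first by rewrite mulr_ge0.
by rewrite rank_oneE normrZ mulrC -mulrA ler_wpM2l// fval_le.
Qed.

Lemma rank_oneBl e e' f : rank_one (e - e') f = rank_one e f - rank_one e' f.
Proof. by apply: compact_op_ext => x; rewrite compact_op_subE !rank_oneE scalerBr. Qed.

Lemma rank_oneBr e f g : rank_one e (f - g) = rank_one e f - rank_one e g.
Proof. by apply: compact_op_ext => x; rewrite compact_op_subE !rank_oneE fvalBl scalerBl. Qed.

Lemma comp_rank_one T e f : compact_op_comp T (rank_one e f) = rank_one (T e) f.
Proof.
apply: compact_op_ext => x; rewrite compact_op_compE !rank_oneE.
exact: bop_linearZ.
Qed.

Lemma rank_one_comp e f T :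
  compact_op_comp (rank_one e f) T = rank_one e (functional_comp f T).
Proof. exact: compact_op_ext. Qed.

(** By the Hahn-Banach theorem this is the image of the closed unit ball of the dual under the
    adjoint of [T]. Its compactness is thus Schauder's theorem, and the present form is visibly
    stable under pointwise limits. *)
Definition dominated_functionals T : set (functional E) :=
  [set h | forall x, `|fval h x| <= `|T x|].

(* The pointwise limit along an ultrafilter is uniform on the unit ball because
   the functionals are equicontinuous for the precompact seminorm [|T x|]. *)
Lemma compact_dominated T : compact (dominated_functionals T : set (functional E)).
Proof.
rewrite compact_ultra => U UU UD.
have PU : ProperFilter U by exact: ultra_proper.
have FU : Filter U by exact: filter_filter.
have /boolp.choice[l lP] x : exists l : K^o, (fun h : functional E => fval h x : K^o) @ U --> l.
  have [B cB BT] := disc_subset_compact `|T x| (scalarFieldP K).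
  have UB : U [set h | B (fval h x)].
    by apply: (@filterS _ U FU (dominated_functionals T)) UD => h hT; apply/BT/hT.
  have := cB; rewrite compact_ultra.
  by move=> /(_ _ (ultra_fmap (fun h => fval h x : K^o) UU) UB)[l [_ Ul]]; exists l.
have lT x : `|l x| <= `|T x|.
  have := @norm_sub_limit_le K K^o _ U PU (fun h => fval h x) (l x) 0 `|T x| (lP x).
  rewrite sub0r normrN; apply.
  apply: (@filterS _ U FU (dominated_functionals T)) UD => h hT.
  by rewrite sub0r normrN; exact: hT.
have [|x|h0 h0E] := @functional_of_linear K E l `|T|.
- move=> a x y; apply: (norm_cvg_unique (lP _)).
  have -> : (fun h : functional E => fval h (a *: x + y) : K^o) =
      (fun h : functional E => (a *: (fval h x : K^o) + fval h y : K^o)).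
    by apply/funext => h; rewrite fvalD fvalZ.
  by apply: cvgD; [apply: cvgZr|]; exact: lP.
- by apply: (le_trans (lT x)); exact: compact_op_le.
have h0T : dominated_functionals T h0 by move=> x; rewrite h0E.
exists h0; split=> //; apply/cvgrPdist_le => e e0.
have e30 : 0 < e / 3 by rewrite divr_gt0.
have [n [y [Ty yP]]] := precompact_net (compact_opP T) e30.
have /boolp.choice[z zP] i : exists z, `|z| <= 1 /\ T z = y i.
  by have [z] := Ty i; exists z.
have nearz : \forall h \near U, forall i, `|fval h0 (z i) - fval h (z i)| <= e / 3.
  apply: filter_forall => i; rewrite h0E.
  by have /cvgrPdist_le := lP (z i); apply.
near=> h; have hT : dominated_functionals T h by near: h.
apply: opnorm_ball_le => [|x x1]; first exact: ltW.
rewrite -[X in `|X|]/(fval (h0 - h) x) fvalBl.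
have [i xi] := yP (T x) (ex_intro2 _ _ x x1 erefl).
have Tzi : `|T (x - z i)| <= e / 3.
  by have [_ zi] := zP i; rewrite compact_op_linearB zi ltW.
have -> : fval h0 x - fval h x =
    fval h0 (x - z i) + (fval h0 (z i) - fval h (z i)) - fval h (x - z i).
  by rewrite !fvalB; ring.
rewrite (le_trans (ler_normB _ _))//.
have -> : e = e / 3 + e / 3 + e / 3 by field.
rewrite lerD ?(le_trans (hT _))// (le_trans (ler_normD _ _))//.
rewrite lerD ?(le_trans (h0T _))//; move: i {yP xi Tzi}; near: h.
exact: nearz.
Unshelve. all: by end_near. Qed.

End RankOne.

Arguments rank_one : simpl never.

(** * Approximating a compact operator from within the ideals it generates *)

Section Approximation.
Context {K : scalarFieldType} (E : completeNormedModType K).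
Implicit Types (x y : E) (f g h : functional E) (S T : compact_op E).

(** The sum is [S T], where [S] has finite rank and is close to the identity on the image of the
    unit ball. Each summand is a product of a rank-one operator with [T], hence lies in every left
    ideal containing [T]. *)
Lemma left_approximation T (e : K) : approximation_property E -> 0 < e ->
  exists s : seq (functional E * E),
    `|T - \sum_(p <- s) rank_one p.2 (functional_comp p.1 T)| <= e.
Proof.
move=> ap e0.
have cT : compact (closure (T @` [set x | `|x| <= 1])).
  by rewrite -precompactE; exact: compact_opP.
have [S /finite_rank_sum[s sS] Se] := ap _ cT _ e0.
exists s; apply: compact_op_ball_le => [|x x1]; first exact: ltW.
rewrite compact_op_subE compact_op_sumE distrC.
have -> : \sum_(p <- s) rank_one p.2 (functional_comp p.1 T) x = S (T x).
  by rewrite sS; apply: eq_bigr => p _.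
by apply/ltW/Se/subset_closure; exists x.
Qed.

(* Goldstine's theorem for the image of [T]: as [T] is compact, [T'' Phi] is a
   norm limit of points [T x]. *)
Lemma bidual_approximation T (Phi : functional (functional E)) (e : K) : 0 < e ->
  exists x, forall h, dominated_functionals T h -> `|fval Phi h - fval h x| <= e.
Proof.
(* With the norm bound of [helly], [M] dominates [|Phi| + |x|]. *)
move=> e0; pose M := 2 * `|Phi| + 1; have M0 : 0 < M by rewrite ltr_wpDl ?mulr_ge0.
have [n [u [_ uP]]] := compact_net (@compact_dominated K E T) (divr_gt0 e0 M0).
have [x [xPhi xu]] := helly Phi (codom u).
exists x => h hT; have [j hj] := uP h hT.
have -> : fval Phi h - fval h x = fval Phi (h - u j) - fval (h - u j) x.
  by rewrite fvalB fvalBl (xu (u j)) ?codom_f//; ring.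
rewrite (le_trans (ler_normB _ _))// (le_trans (lerD (fval_le _ _) (fval_le _ _)))//.
rewrite [X in X + _]mulrC -mulrDr.
apply: (@le_trans _ _ (`|h - u j| * M)).
  by rewrite ler_wpM2l// /M mulr_natl mulr2n -addrA lerD2l.
by rewrite -ler_pdivlMr// ltW.
Qed.

Lemma right_approximation T (e : K) : approximation_property (dual E) -> 0 < e ->
  exists s : seq (E * functional E),
    `|T - \sum_(p <- s) rank_one (T p.1) p.2| <= e.
Proof.
move=> ap e0; have e20 : 0 < e / 2 by rewrite divr_gt0.
have [R /finite_rank_sum[s sR] Re] := ap _ (@compact_dominated K E T) _ e20.
(* Replacing each bidual element [p.1] by a point, up to [d], costs at most [d] times the sum of the
   [|p.2|], hence at most [e / 2]; the added 1 keeps [B] positive. *)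
pose B := \sum_(p <- s) `|p.2 : functional E| + 1.
have B0 : 0 < B by rewrite ltr_wpDl ?sumr_ge0.
have d0 := divr_gt0 e20 B0; pose d := e / 2 / B.
have /boolp.choice[u uP] (Phi : functional (functional E)) :
    exists x, forall h, dominated_functionals T h -> `|fval Phi h - fval h x| <= d.
  exact: bidual_approximation.
exists [seq (u p.1, p.2) | p <- s]; rewrite big_map.
apply: compact_op_ball_le => [|x x1]; first exact: ltW.
rewrite compact_op_subE compact_op_sumE.
(* The error at [x] is measured by a norming functional [h]. Since [h o T] is dominated by [T], the
   estimates for [R] and for [u] both apply to it. *)
set y := (X in `|X|); have [h [hn hy]] := norming_functional y.
have hT : dominated_functionals T (functional_comp h T) by move=> z; exact: hn.
rewrite -(ger0_norm (normr_ge0 y)) -hy /y fvalB fval_sum.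
(* The error splits into that of [R] on [h o T] and that of replacing the bidual elements by
   points. *)
have -> : \sum_(p <- s) fval h (rank_one (T (u p.1)) p.2 x) =
    fval (R (functional_comp h T)) x -
    \sum_(p <- s) (fval p.1 (functional_comp h T) - fval (functional_comp h T) (u p.1)) * fval p.2 x.
  rewrite sR fval_suml -sumrB; apply: eq_bigr => p _.
  by rewrite rank_oneE !fvalZ fvalZl functional_compE; ring.
rewrite opprB addrA -functional_compE [X in `|X|](_ : _ = 
  \sum_(p <- s) (fval p.1 (functional_comp h T) - fval (functional_comp h T) (u p.1)) * fval p.2 x
  - fval (R (functional_comp h T) - functional_comp h T) x); last by rewrite fvalBl; ring.
rewrite (le_trans (ler_normB _ _))// [e in _ <= e]splitr lerD//.
  rewrite (le_trans (ler_norm_sum _ _ _))//.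
  apply: (@le_trans _ _ (\sum_(p <- s) d * `|p.2 : functional E|)).
    apply: ler_sum => p _; rewrite normrM ler_pM//; first exact: uP.
    by rewrite (le_trans (fval_le _ _))// ler_piMr.
  rewrite -mulr_sumr /d -ler_pdivlMl//.
  by rewrite invf_div divfK ?(gt_eqF e20)// lerDl.
rewrite (le_trans (fval_le _ _))// ltW// (le_lt_trans _ (Re _ hT))//.
by rewrite ler_piMr.
Qed.

End Approximation.

(** * Ideals *)

Section Ideals.
Context {K : scalarFieldType} (A : banachAlgType K).
Implicit Types (I J : set A) (x y a : A).

Lemma linear_subspaceZ I (c : K) x : linear_subspace I -> I x -> I (c *: x).
Proof. by move=> [I0 IL] Ix; rewrite -[_ *: _]addr0; exact: IL. Qed.

Lemma linear_subspaceD I x y : linear_subspace I -> I x -> I y -> I (x + y).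
Proof. by move=> [_ IL] Ix Iy; rewrite -[x]scale1r; exact: IL. Qed.

Lemma linear_subspace_sum I (T : eqType) (r : seq T) (x : T -> A) :
  linear_subspace I -> (forall j, j \in r -> I (x j)) -> I (\sum_(j <- r) x j).
Proof.
move=> IL Ix; rewrite big_seq; apply: (big_ind I) => //; first exact: IL.1.
by move=> *; exact: linear_subspaceD.
Qed.

Lemma linear_subspace_closure I : linear_subspace I -> linear_subspace (closure I).
Proof.
move=> [I0 IL]; split=> [|c x y Ix Iy]; first exact: subset_closure.
apply/closure_normP => e e0; have e20 : 0 < e / 2 by rewrite divr_gt0.
have c0 : 0 < 1 + `|c| by rewrite ltr_pwDl.
have [z Iz xz] := (closure_normP _ _).1 Ix _ (divr_gt0 e20 c0).
have [w Iw yw] := (closure_normP _ _).1 Iy _ e20.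
exists (c *: z + w); first exact: IL.
rewrite opprD addrACA -scalerBr (le_lt_trans (ler_normD _ _))// (splitr e) ltrD//.
rewrite normrZ; rewrite ltr_pdivlMr// mulrC in xz; apply: le_lt_trans xz.
by rewrite ler_wpM2r// lerDr.
Qed.

Lemma in_span_subspace J v x :
  linear_subspace J -> (forall y, y \in v -> J y) -> in_span v x -> J x.
Proof.
move=> JL; elim: v x => [x _ ->|a v IH x Jv [c /IH Jx]]; first exact: JL.1.
rewrite -(subrK (c *: a) x); apply: linear_subspaceD => //.
  by apply: Jx => y yv; apply: Jv; rewrite inE yv orbT.
by apply: linear_subspaceZ => //; apply: Jv; exact: mem_head.
Qed.

(** Elimination on [v]: the induction hypothesis handles the elements of [I] spanned by the tail,
    and a single [y] in [I] with nonzero coefficient [c] at [a], if there is one, reduces all others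
    to these. *)
Lemma subspace_finite_span I (v : seq A) : linear_subspace I ->
  (forall x, I x -> in_span v x) ->
  exists w : seq A, (forall y, y \in w -> I y) /\ forall x, I x -> in_span w x.
Proof.
elim: v I => [|a v IH] I IL Iv; first by exists [::].
pose I' := [set x | I x /\ in_span v x].
have [|x [_ //]|w [wI' I'w]] := IH I'.
  split; first by split; [exact: IL.1|exact: in_span0].
  move=> c x y [Ix sx] [Iy sy]; split; first exact: IL.2.
  exact: in_spanP.
have [[y [c [c0 [Iy sy]]]]|ny] := pselect (exists y c, c != 0 /\ (I y /\ in_span v (y - c *: a))).
  exists (y :: w); split=> [z|x Ix] /=.
    by rewrite inE => /predU1P[->//|/wI'[]].
  have [d sx] := Iv x Ix; exists (d / c); apply: I'w; split.
    by rewrite addrC -scaleNr; exact: IL.2.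
  have := in_spanP (- (d / c)) sy sx; congr in_span.
  rewrite scalerBr scalerA mulNr divfK// !scaleNr opprK addrACA.
  by rewrite subrr addr0 addrC.
exists w; split=> [z /wI'[]//|x Ix]; apply: I'w; split=> //.
have [c sx] := Iv x Ix; have [c0|c0] := eqVneq c 0.
  by move: sx; rewrite c0 scale0r subr0.
by exfalso; apply: ny; exists x, c.
Qed.

Lemma closed_limit I (Y : nat -> A) (X : A) :
  closed I -> (forall N, I (Y N)) -> Y @ \oo --> X -> I X.
Proof.
move=> cI IY YX; apply: cI; apply/closure_normP => e e0.
have /cvgrPdist_lt/(_ e e0)[N _ YN] := YX.
by exists (Y N) => //; apply: YN => /=.
Qed.

(** Continuity of the product, in the form needed for a series whose partial sums have a constant
    product with [a] from some index on. *)
Lemma bmul_limit a (Y : nat -> A) (X Z : A) n : Y @ \oo --> X ->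
  ((forall N, (n < N)%N -> bmul a (Y N) = Z) -> bmul a X = Z) /\
  ((forall N, (n < N)%N -> bmul (Y N) a = Z) -> bmul X a = Z).
Proof.
move=> /cvgrPdist_lt YX; have a0 : 0 < 1 + `|a| by rewrite ltr_pwDl.
have small e : 0 < e -> exists2 N, (n < N)%N & `|X - Y N| * `|a| <= e.
  move=> e0; have [M _ YM] := YX _ (divr_gt0 e0 a0).
  exists (n.+1 + M)%N; first by rewrite addSn ltnS leq_addr.
  have := YM (n.+1 + M)%N (leq_addl _ _); rewrite ltr_pdivlMr// => /ltW.
  by apply: le_trans; rewrite ler_wpM2l// lerDr.
have bmulBr x y z : bmul x (y - z) = bmul x y - bmul x z.
  by rewrite -scaleN1r bmulDr bmulZr scaleN1r.
have bmulBl x y z : bmul (y - z) x = bmul y x - bmul z x.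
  by rewrite -scaleN1r bmulDl bmulZl scaleN1r.
have eq0 (x : A) : (forall e : K, 0 < e -> `|x| <= e) -> x = 0.
  move=> xe; apply/eqP; rewrite -normr_le0; apply/ler_addgt0Pr => e e0.
  by rewrite add0r; exact: xe.
split=> YZ; apply/eqP; rewrite -subr_eq0; apply/eqP/eq0 => e /small[N nN Ne].
  rewrite -(YZ N nN) -bmulBr (le_trans (bmul_norm _ _))//.
  by rewrite mulrC.
by rewrite -(YZ N nN) -bmulBl (le_trans (bmul_norm _ _)).
Qed.

(** In a unital algebra the second component must vanish, so [c] is represented by [c] times the
    identity instead of by [(0, c)]. *)
Lemma unitisation_scalar (c : K) : exists u : A * K, unitisation u /\
  forall x, unit_mull u x = c *: x /\ unit_mulr x u = c *: x.
Proof.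
have [[e eP]|nu] := pselect (is_unital A).
  exists (c *: e, 0); split=> // x; have [ex xe] := eP x.
  by rewrite /unit_mull /unit_mulr /= scale0r !addr0 bmulZl bmulZr ex xe.
exists (0, c); split=> // x; rewrite /unit_mull /unit_mulr /=.
have := bmulZl 0 0 x; have := bmulZr 0 x 0.
by rewrite !scale0r => -> ->; rewrite !add0r.
Qed.

Lemma unitisation_alg a : unitisation (a, 0) /\
  forall x, unit_mull (a, 0) x = bmul a x /\ unit_mulr x (a, 0) = bmul x a.
Proof. by split=> // x; rewrite /unit_mull /unit_mulr /= scale0r !addr0. Qed.

Lemma unitisation_linear (c : K) (u v : A * K) (w := (c *: u.1 + v.1, c * u.2 + v.2)) :
  unitisation u -> unitisation v -> unitisation w /\ forall x,
    unit_mull w x = c *: unit_mull u x + unit_mull v x /\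
    unit_mulr x w = c *: unit_mulr x u + unit_mulr x v.
Proof.
move=> uu uv; split=> [un|x].
  by rewrite /= uu// uv// mulr0 addr0.
rewrite /unit_mull /unit_mulr /= bmulDl bmulZl bmulDr bmulZr !scalerDl.
by rewrite !scalerDr !scalerA; split; rewrite addrACA.
Qed.

Lemma left_combinations_subspace n (x : 'I_n -> A) :
  linear_subspace (left_combinations x).
Proof.
have [z [zu z0]] := unitisation_scalar 0.
split=> [|c _ _ [u uu ->] [v vu ->]].
  by exists (fun=> z) => //; rewrite big1// => i _; rewrite (z0 _).1 scale0r.
exists (fun i => (c *: (u i).1 + (v i).1, c * (u i).2 + (v i).2)) => [i|].
  by have [] := unitisation_linear c (uu i) (vu i).
rewrite scaler_sumr -big_split; apply: eq_bigr => i _ /=.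
by rewrite ((unitisation_linear c (uu i) (vu i)).2 _).1.
Qed.

Lemma right_combinations_subspace n (x : 'I_n -> A) :
  linear_subspace (right_combinations x).
Proof.
have [z [zu z0]] := unitisation_scalar 0.
split=> [|c _ _ [u uu ->] [v vu ->]].
  by exists (fun=> z) => //; rewrite big1// => i _; rewrite (z0 _).2 scale0r.
exists (fun i => (c *: (u i).1 + (v i).1, c * (u i).2 + (v i).2)) => [i|].
  by have [] := unitisation_linear c (uu i) (vu i).
rewrite scaler_sumr -big_split; apply: eq_bigr => i _ /=.
by rewrite ((unitisation_linear c (uu i) (vu i)).2 _).2.
Qed.

Lemma left_combinations_unit_mull n (x : 'I_n -> A) u i :
  unitisation u -> left_combinations x (unit_mull u (x i)).
Proof.
move=> uu; have [z [zu z0]] := unitisation_scalar 0.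
exists (fun j => if j == i then u else z) => [j|]; first by case: ifP.
by rewrite (bigD1 i)//= eqxx big1 ?addr0// => j /negbTE ->; rewrite (z0 _).1 scale0r.
Qed.

Lemma right_combinations_unit_mulr n (x : 'I_n -> A) u i :
  unitisation u -> right_combinations x (unit_mulr (x i) u).
Proof.
move=> uu; have [z [zu z0]] := unitisation_scalar 0.
exists (fun j => if j == i then u else z) => [j|]; first by case: ifP.
by rewrite (bigD1 i)//= eqxx big1 ?addr0// => j /negbTE ->; rewrite (z0 _).2 scale0r.
Qed.

Lemma left_ideal_eq_closure I n (x : 'I_n -> A) : left_ideal I -> closed I ->
  (forall i, I (x i)) -> I `<=` closure (left_combinations x) ->
  I = closure (left_combinations x).
Proof.
move=> [IL Im] cI Ix Isub; apply/seteqP; split=> //.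
rewrite [X in _ `<=` X](closure_id I).1//; apply: closureS => _ [u _ ->].
apply: linear_subspace_sum => // i _; apply: linear_subspaceD => //; first exact: Im.
exact: linear_subspaceZ.
Qed.

Lemma right_ideal_eq_closure I n (x : 'I_n -> A) : right_ideal I -> closed I ->
  (forall i, I (x i)) -> I `<=` closure (right_combinations x) ->
  I = closure (right_combinations x).
Proof.
move=> [IL Im] cI Ix Isub; apply/seteqP; split=> //.
rewrite [X in _ `<=` X](closure_id I).1//; apply: closureS => _ [u _ ->].
apply: linear_subspace_sum => // i _; apply: linear_subspaceD => //; first exact: Im.
exact: linear_subspaceZ.
Qed.

(** This settles the spaces with a finite basis: an ideal then has a finite linear spanning list,
    which generates it. *)
Lemma finite_span_Noetherian (v : seq A) : (forall x, in_span v x) ->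
  topologically_left_Noetherian A /\ topologically_right_Noetherian A.
Proof.
move=> Av; have [u1 [u1u u1P]] := unitisation_scalar 1; split=> I II cI.
  have [w [wI Iw]] := subspace_finite_span II.1 (fun x _ => Av x).
  exists (size w), (tnth (in_tuple w)).
  have wi i : I (tnth (in_tuple w) i) by apply: wI; rewrite mem_tnth.
  split=> //; apply: left_ideal_eq_closure => // x Ix; apply: subset_closure.
  apply: (in_span_subspace (left_combinations_subspace _) _ (Iw x Ix)) => y.
  move=> yw; have /tnthP[i ->] : y \in in_tuple w by [].
  have := left_combinations_unit_mull (tnth (in_tuple w)) i u1u.
  by rewrite (u1P _).1 scale1r.
have [w [wI Iw]] := subspace_finite_span II.1 (fun x _ => Av x).
exists (size w), (tnth (in_tuple w)).
have wi i : I (tnth (in_tuple w) i) by apply: wI; rewrite mem_tnth.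
split=> //; apply: right_ideal_eq_closure => // x Ix; apply: subset_closure.
apply: (in_span_subspace (right_combinations_subspace _) _ (Iw x Ix)) => y.
move=> yw; have /tnthP[i ->] : y \in in_tuple w by [].
have := right_combinations_unit_mulr (tnth (in_tuple w)) i u1u.
by rewrite (u1P _).2 scale1r.
Qed.

End Ideals.

(** * Noetherian conditions and separability *)

Section Noetherian.
Context {K : scalarFieldType} (E : completeNormedModType K).
Implicit Types (x y : E) (f g h : functional E) (S T : compact_op E).

Lemma unit_mull_compactE S T (c : K) x :
  (unit_mull ((S, c) : compact_operators E * K) T : compact_op E) x =
  S (T x) + c *: T x.
Proof. by []. Qed.

Lemma unit_mulr_compactE S T (c : K) x :
  (unit_mulr T ((S, c) : compact_operators E * K) : compact_op E) x =
  T (S x) + c *: T x.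
Proof. by []. Qed.

(** The operators [rank_one p.1 q.2] act as matrix units, with the matrix entries [p.2 (T q.1)] as
    coefficients. *)
Lemma finite_basis_in_span (t : seq (E * functional E)) :
  (forall x, x = \sum_(p <- t) fval p.2 x *: p.1) ->
  exists v : seq (compact_operators E), forall T, in_span v T.
Proof.
move=> tP; pose r := [seq (p, q) | q <- t, p <- t].
exists [seq rank_one w.1.1 w.2.2 : compact_operators E | w <- r] => T.
have -> : T = \sum_(w <- r) fval w.1.2 (T w.2.1) *: rank_one w.1.1 w.2.2.
  apply: compact_op_ext => x; rewrite compact_op_sumE big_allpairs_dep.
  rewrite (_ : T x = \sum_(q <- t) fval q.2 x *: T q.1).
    apply: eq_bigr => q _ /=; set a := T q.1; rewrite {1}[a]tP scaler_sumr.
    apply: eq_bigr => p _; rewrite -[RHS]/(fval p.2 a *: (fval q.2 x *: p.1)).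
    by rewrite !scalerA mulrC.
  rewrite {1}[x]tP -[LHS]/((T : bounded_op E E) _) linear_sum.
  by apply: eq_bigr => q _; rewrite linearZ.
exact: in_span_sum.
Qed.

Lemma separable_left_Noetherian : approximation_property E ->
  separable_space (dual E) -> topologically_left_Noetherian (compact_operators E).
Proof.
move=> ap sep.
case: (finite_basis_or_biorthogonal E) => [[t /finite_basis_in_span[v vP]]|[e [u eu]]].
  by have [] := finite_span_Noetherian vP.
move=> I II cI; have [IL Im] := II.
pose F : set (functional E) := [set f | forall y, I (rank_one y f)].
have F0 : F 0.
  move=> y; rewrite (_ : rank_one y 0 = 0); first exact: IL.1.
  by apply: compact_op_ext => x; rewrite rank_oneE; exact: scale0r.
have caF : countably_approximable F.
  by apply: countably_approximable_sub ((separable_countably_approximable _).1 sep).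
have [f [fF fP]] := countably_approximable_inner F0 caF.
have [c [c0 Xc]] := exists_convergent_scaling (fun n => rank_one (e n) (f n)).
set Y := (fun N => _) in Xc; pose X : compact_operators E := lim (Y @ \oo).
have YX : (Y : nat -> compact_operators E) @ \oo --> X by exact: Xc.
have IX : I X.
  apply: (closed_limit cI) YX => N; apply: linear_subspace_sum => // n _.
  by apply: linear_subspaceZ => //; exact: fF.
(* By biorthogonality, [u n] keeps only the term of index [n] in every partial sum with [N > n]. *)
have compX y n : compact_op_comp (rank_one y (u n)) X = c n *: rank_one y (f n).
  apply: ((@bmul_limit _ _ (rank_one y (u n) : compact_operators E) _ _ _ n YX).1) => N nN.
  apply: compact_op_ext => x; rewrite compact_op_compE rank_oneE compact_op_sumE.
  rewrite fval_sum scale_rank_oneE; congr (_ *: _).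
  under eq_bigr do rewrite scale_rank_oneE fvalZ eu.
  rewrite (bigD1 (Ordinal nN))//= big1 ?addr0 ?eqxx ?mulr1// => i ne.
  case: eqP => [ni|_]; last by rewrite mulr0.
  by case/eqP: ne; apply/val_inj.
exists 1%N, (fun=> X); split=> //.
apply: left_ideal_eq_closure => //.
set J := closure _.
have JL : linear_subspace J.
  by apply: linear_subspace_closure; exact: left_combinations_subspace.
have Jn y n : J (rank_one y (f n)).
  suff Jc : J (compact_op_comp (rank_one y (u n)) X).
    have <- : (c n)^-1 *: compact_op_comp (rank_one y (u n)) X = rank_one y (f n).
      by rewrite compX scalerK.
    exact (linear_subspaceZ (c n)^-1 JL Jc).
  apply: subset_closure.
  have [ua uaP] := unitisation_alg (rank_one y (u n) : compact_operators E).
  rewrite -[compact_op_comp _ _](uaP X).1.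
  exact: (left_combinations_unit_mull (fun=> X) ord0 ua).
have JF y g : F g -> J (rank_one y g).
  move=> Fg; apply: closed_closure; apply/closure_normP => d d0.
  have y0 : 0 < 1 + `|y| by rewrite ltr_pwDl.
  have [n gn] := fP g Fg _ (divr_gt0 d0 y0).
  exists (rank_one y (f n)); first exact: Jn.
  rewrite -rank_oneBr (le_lt_trans (rank_one_norm _ _))//.
  rewrite ltr_pdivlMr// mulrC in gn; apply: le_lt_trans gn.
  by rewrite ler_wpM2r// lerDr.
move=> T IT; apply: closed_closure; apply/closure_normP => d d0.
have [s sT] := left_approximation T ap (divr_gt0 d0 (ltr0n K 2)).
eexists; last by apply: le_lt_trans sT _; rewrite ltr_pdivrMr// ltr_pMr// ltr1n.
(* For every [y], [rank_one y (p.1 o T)] is the product of [rank_one y p.1] with [T], so it lies in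
   [I]; hence [p.1 o T] belongs to [F]. *)
apply: linear_subspace_sum => // p _; apply: JF => y.
by rewrite -rank_one_comp; exact: Im.
Qed.

Lemma separable_right_Noetherian : approximation_property (dual E) ->
  separable_space E -> topologically_right_Noetherian (compact_operators E).
Proof.
move=> ap sep.
case: (finite_basis_or_biorthogonal E) => [[t /finite_basis_in_span[v vP]]|[e [u eu]]].
  by have [] := finite_span_Noetherian vP.
move=> I II cI; have [IL Im] := II.
pose G : set E := [set y | forall f, I (rank_one y f)].
have G0 : G 0.
  move=> f; rewrite (_ : rank_one 0 f = 0); first exact: IL.1.
  by apply: compact_op_ext => x; rewrite rank_oneE; exact: scaler0.
have caG : countably_approximable G.
  by apply: countably_approximable_sub ((separable_countably_approximable _).1 sep).
have [y [yG yP]] := countably_approximable_inner G0 caG.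
have [c [c0 Xc]] := exists_convergent_scaling (fun n => rank_one (y n) (u n)).
set Y := (fun N => _) in Xc; pose X : compact_operators E := lim (Y @ \oo).
have YX : (Y : nat -> compact_operators E) @ \oo --> X by exact: Xc.
have IX : I X.
  apply: (closed_limit cI) YX => N; apply: linear_subspace_sum => // n _.
  by apply: linear_subspaceZ => //; exact: yG.
(* Here multiplication on the right by [rank_one (e n) f] evaluates the series at [e n], which
   leaves the term in [y n]. *)
have compX f n : compact_op_comp X (rank_one (e n) f) = c n *: rank_one (y n) f.
  apply: ((@bmul_limit _ _ (rank_one (e n) f : compact_operators E) _ _ _ n YX).2) => N nN.
  apply: compact_op_ext => x.
  rewrite -[LHS]/(compact_op_comp (Y N) (rank_one (e n) f) x) comp_rank_one.
  rewrite rank_oneE scale_rank_oneE mulrC -scalerA; congr (_ *: _).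
  rewrite compact_op_sumE; under eq_bigr do rewrite scale_rank_oneE eu.
  rewrite (bigD1 (Ordinal nN))//= big1 ?addr0 ?eqxx ?mulr1// => i ne.
  case: eqP => [ni|_]; last by rewrite mulr0 scale0r.
  by case/eqP: ne; apply/val_inj.
exists 1%N, (fun=> X); split=> //.
apply: right_ideal_eq_closure => //.
set J := closure _.
have JL : linear_subspace J.
  by apply: linear_subspace_closure; exact: right_combinations_subspace.
have Jn f n : J (rank_one (y n) f).
  suff Jc : J (compact_op_comp X (rank_one (e n) f)).
    have <- : (c n)^-1 *: compact_op_comp X (rank_one (e n) f) = rank_one (y n) f.
      by rewrite compX scalerK.
    exact (linear_subspaceZ (c n)^-1 JL Jc).
  apply: subset_closure.
  have [ua uaP] := unitisation_alg (rank_one (e n) f : compact_operators E).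
  rewrite -[compact_op_comp _ _](uaP X).2.
  exact: (right_combinations_unit_mulr (fun=> X) ord0 ua).
have JG z f : G z -> J (rank_one z f).
  move=> Gz; apply: closed_closure; apply/closure_normP => d d0.
  have f0 : 0 < 1 + `|f| by rewrite ltr_pwDl.
  have [n zn] := yP z Gz _ (divr_gt0 d0 f0).
  exists (rank_one (y n) f); first exact: Jn.
  rewrite -rank_oneBl (le_lt_trans (rank_one_norm _ _))//.
  rewrite ltr_pdivlMr// in zn; apply: le_lt_trans zn.
  by rewrite ler_wpM2l// lerDr.
move=> T IT; apply: closed_closure; apply/closure_normP => d d0.
have [s sT] := right_approximation T ap (divr_gt0 d0 (ltr0n K 2)).
eexists; last by apply: le_lt_trans sT _; rewrite ltr_pdivrMr// ltr_pMr// ltr1n.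
(* For every [f], [rank_one (T p.1) f] is the product of [T] with [rank_one p.1 f], so [T p.1]
   belongs to [G]. *)
apply: linear_subspace_sum => // p _; apply: JG => f.
by rewrite -comp_rank_one; exact: Im.
Qed.

(** Both converse directions test against a rank-one operator built with [u0 x0 = 1], so the zero
    space is set apart. *)
Lemma zero_or_functional : (forall x, x = 0) \/ exists x f, fval f x = 1.
Proof.
have [[x x0]|n0] := pselect (exists x, x != 0); last first.
  by left=> x; apply/eqP/negPn/negP => x0; apply: n0; exists x.
by right; have [f fx] := separating_functional x0; exists x, f.
Qed.

Lemma left_Noetherian_separable :
  topologically_left_Noetherian (compact_operators E) -> separable_space (dual E).
Proof.
move=> noeth; case: zero_or_functional => [E0|[x0 [u0 ux0]]].
  apply: (@separable_of_span _ _ 0 (fun=> setT)) => [[]//|f e e0].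
  exists (fun=> 0), (fun=> 0); split=> //; rewrite big_ord0 subr0.
  rewrite (_ : f = 0) ?normr0//.
  by apply: functional_ext => x; rewrite (E0 x) -[0 in LHS](subrr 0) fvalB subrr.
have [|n [T [_ TE]]] := noeth setT _ closedT; first by [].
apply: (@separable_of_span _ _ n (fun i => dominated_functionals (T i))) => [i|f e e0].
  exact/compact_countably_approximable/compact_dominated.
have u00 : 0 < 1 + `|u0| by rewrite ltr_pwDl.
(* Composing with [u0] recovers [f] from [rank_one x0 f]; the tolerance is divided by [1 + |u0|] to
   pay for it. *)
have : closure (left_combinations T) (rank_one x0 f) by rewrite -TE.
move=> /closure_normP/(_ _ (divr_gt0 e0 u00))[_ [w _ ->] fw].
(* Composing [u0] with the product of [w i] and [T i] gives [g i o T i]. Division by [d i] brings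
   the norm of [g i] below 1, so that the result is dominated by [T i]. *)
pose g i : functional E := functional_comp u0 (w i).1 + (w i).2 *: u0.
pose d i : K := 1 + `|g i|; have d0 i : 0 < d i by rewrite ltr_pwDl.
exists d, (fun i => (d i)^-1 *: functional_comp (g i) (T i)); split=> [i x|].
  rewrite fvalZl functional_compE normrM normfV (gtr0_norm (d0 i)).
  rewrite ler_pdivrMl// (le_trans (fval_le _ _))// ler_wpM2r//.
  by rewrite /d lerDr.
have -> : f - \sum_(i < n) d i *: ((d i)^-1 *: functional_comp (g i) (T i)) =
    functional_comp u0 (rank_one x0 f - \sum_(i < n) unit_mull (w i) (T i)).
  apply: functional_ext => x; rewrite functional_compE.
  rewrite (compact_op_subE (rank_one x0 f)) (compact_op_sumE (index_enum 'I_n)).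
  rewrite fvalB rank_oneE fvalZ ux0 mulr1 fvalBl fval_suml fval_sum.
  congr (_ - _); apply: eq_bigr => i _; rewrite !fvalZl mulrA mulfV ?mul1r ?gt_eqF//.
  rewrite functional_compE fvalDl fvalZl functional_compE.
  by rewrite [w i]surjective_pairing unit_mull_compactE fvalD fvalZ.
apply: (@le_lt_trans _ _ (`|u0| * (`|rank_one x0 f - \sum_(i < n) unit_mull (w i) (T i)|))).
  apply: functional_norm_le => [|x]; first by rewrite mulr_ge0.
  rewrite functional_compE (le_trans (fval_le _ _))// -mulrA ler_wpM2l//.
  exact: compact_op_le.
rewrite ltr_pdivlMr// mulrC in fw; apply: le_lt_trans fw.
by rewrite ler_wpM2r// lerDr.
Qed.

Lemma right_Noetherian_separable :
  topologically_right_Noetherian (compact_operators E) -> separable_space E.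
Proof.
move=> noeth; case: zero_or_functional => [E0|[x0 [u0 ux0]]].
  apply: (@separable_of_span _ _ 0 (fun=> setT)) => [[]//|x e e0].
  by exists (fun=> 0), (fun=> 0); split=> //; rewrite big_ord0 subr0 (E0 x) normr0.
have [|n [T [_ TE]]] := noeth setT _ closedT; first by [].
pose B i := (T i : compact_op E) @` [set x | `|x| <= 1].
apply: (@separable_of_span _ _ n B) => [i|y e e0].
  exact/precompact_countably_approximable/compact_opP.
have x00 : 0 < 1 + `|x0| by rewrite ltr_pwDl.
have : closure (right_combinations T) (rank_one y u0) by rewrite -TE.
move=> /closure_normP/(_ _ (divr_gt0 e0 x00))[_ [w _ ->] fw].
(* Evaluation at [x0] turns [rank_one y u0] into [y] and the product of [T i] with [w i] into
   [T i (z i)]; dividing by [d i] moves [z i] into the unit ball. *)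
pose z i : E := ((w i).1 : compact_op E) x0 + (w i).2 *: x0.
pose d i : K := 1 + `|z i|; have d0 i : 0 < d i by rewrite ltr_pwDl.
exists d, (fun i => (T i : compact_op E) ((d i)^-1 *: z i)); split=> [i|].
  exists ((d i)^-1 *: z i) => //=.
  by rewrite normrZ normfV (gtr0_norm (d0 i)) ler_pdivrMl// mulr1 /d lerDr.
have -> : y - \sum_(i < n) d i *: (T i : compact_op E) ((d i)^-1 *: z i) =
    (rank_one y u0 - \sum_(i < n) unit_mulr (T i) (w i) : compact_op E) x0.
  rewrite (compact_op_subE (rank_one y u0)) (compact_op_sumE (index_enum 'I_n)).
  rewrite rank_oneE ux0 scale1r; congr (_ - _); apply: eq_bigr => i _.
  rewrite [w i]surjective_pairing unit_mulr_compactE.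
  rewrite -!(bop_linearZ (T i : compact_op E)).
  rewrite -(bop_linearD (T i : compact_op E)).
  by rewrite scalerA mulfV ?scale1r// gt_eqF.
apply: (le_lt_trans (compact_op_le _ _)).
rewrite ltr_pdivlMr// in fw; apply: le_lt_trans fw.
by rewrite ler_wpM2l// lerDr.
Qed.

End Noetherian.

Theorem theorem1p5 (K : scalarFieldType) :
  (forall E : completeNormedModType K,
     approximation_property E ->
     (topologically_left_Noetherian (compact_operators E) <->
      separable_space (dual E)))
  /\
  (forall E : completeNormedModType K,
     bounded_approximation_property (dual E) ->
     (topologically_right_Noetherian (compact_operators E) <->
      separable_space E)).
Proof.
split=> E ap; split.
- exact: left_Noetherian_separable.
- exact: separable_left_Noetherian.
- exact: right_Noetherian_separable.
- apply: separable_right_Noetherian => C cC e e0.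
  by have [M _ /(_ C cC e e0)[T [fT _] Te]] := ap; exists T.
Qed.
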